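(* The Banach space $S$ is complementably minimal; that is, every infinite-dimensional closed subspace of $S$ contains a closed subspace which is isomorphic to $S$ and complemented in $S$.
   Context: Let $c_{00}$ be the space of finitely supported real sequences with standard basis $(e_i)_{i\in\mathbb{N}}$. For nonempty $E,F\subset\mathbb{N}$ write $E<F$ if $\max E<\min F$. For $x=\sum_i x_ie_i\in c_{00}$ and $E\subset\mathbb{N}$ put $E(x)=\sum_{i\in E}x_ie_i$. Let $f(n)=\log_2(n+1)$. The space $S$ (Schlumprecht's space) is the completion of $c_{00}$ under the unique norm $\|\cdot\|$ on $c_{00}$ satisfying the implicit equation $$\|x\|=\max\Big\{\|x\|_{\ell_\infty},\ \sup_{n\ge2,\ E_1<E_2<\dots<E_n}\frac1{f(n)}\sum_{i=1}^n\|E_i(x)\|\Big\},$$ where the supremum is over integers $n\ge2$ and subsets $E_1<\dots<E_n$ of $\mathbb{N}$. *)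

(* Defs.v *)
From HB Require Import structures.
From mathcomp Require Import all_boot all_order all_algebra.
From mathcomp Require Import all_classical all_reals all_analysis.

Set Implicit Arguments.
Unset Strict Implicit.
Unset Printing Implicit Defensive.

Import Order.TTheory GRing.Theory Num.Theory.
Import numFieldNormedType.Exports.

Local Open Scope classical_set_scope.
Local Open Scope ring_scope.

Definition finitely_supported (R : realType) : {pred nat -> R} :=
  [pred x | `[< finite_set [set i | x i != 0] >]].

Lemma finitely_supported_submod_closed (R : realType) :
  submod_closed (@finitely_supported R).
Proof.
split=> [|a x y].
  apply/asboolP; suff -> : [set i | (0 : nat -> R) i != 0] = set0 by [].
  by apply/seteqP; split=> i //=; rewrite eqxx.
move=> /asboolP x_fin /asboolP y_fin; apply/asboolP.
have xy_fin : finite_set ([set i | x i != 0] `|` [set i | y i != 0]).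
  by rewrite finite_setU.
apply: (sub_finite_set _ xy_fin) => i /=.
have [xi0|xi_neq0] := eqVneq (x i) 0; last by left.
have [yi0|yi_neq0] := eqVneq (y i) 0; last by right.
suff -> : (a *: x + y) i = 0 by rewrite eqxx.
by rewrite -[LHS]/(a * x i + y i) xi0 yi0 mulr0 addr0.
Qed.

HB.instance Definition _ (R : realType) :=
  GRing.isSubmodClosed.Build R (nat -> R) (@finitely_supported R)
    (@finitely_supported_submod_closed R).

Record c00 (R : realType) := C00 {
  c00_val :> nat -> R ;
  c00_fin : c00_val \in @finitely_supported R }.

HB.instance Definition _ (R : realType) := [isSub for @c00_val R].
HB.instance Definition _ (R : realType) := [Choice of c00 R by <:].
HB.instance Definition _ (R : realType) :=
  [SubChoice_isSubLmodule of c00 R by <:].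

Definition restr_fun (R : realType) (E : set nat) (x : nat -> R) : nat -> R :=
  fun i => if i \in E then x i else 0.

Lemma restr_fin (R : realType) (E : set nat) (x : c00 R) :
  restr_fun E x \in @finitely_supported R.
Proof.
have /asboolP x_fin := c00_fin x; apply/asboolP.
by apply: (sub_finite_set _ x_fin) => i /=; rewrite /restr_fun; case: ifP;
  rewrite ?eqxx.
Qed.

Definition restr (R : realType) (E : set nat) (x : c00 R) : c00 R :=
  C00 (restr_fin E x).

(** [E < F] for nonempty sets. The last set of a chain may be infinite, whereas
    [F !=set0] forces [E] to be bounded, so that this is [max E < min F]. *)
Definition set_lt (E F : set nat) : Prop :=
  [/\ E !=set0, F !=set0 & forall i j, E i -> F j -> (i < j)%N].

(** [log_2 (n + 1)] *)
Definition schlumprecht_f (R : realType) (n : nat) : R := ln n.+1%:R / ln 2.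

(** Suprema are taken in [\bar R], since [sup] of an unbounded subset of [R] is
    a junk value. *)
Definition schlumprecht_equation (R : realType) (N : c00 R -> R) : Prop :=
  forall x : c00 R,
    (N x)%:E = maxe
      (ereal_sup [set `|x i|%:E | i in [set: nat]])
      (ereal_sup [set r : \bar R |
         exists (n : nat) (E : 'I_n -> set nat),
           [/\ (2 <= n)%N,
               forall i j : 'I_n, (i < j)%N -> set_lt (E i) (E j) &
               r = ((schlumprecht_f R n)^-1 * \sum_(i < n) N (restr (E i) x))%:E]]).

Definition is_norm (R : realType) (V : lmodType R) (N : V -> R) : Prop :=
  [/\ forall x, N x = 0 -> x = 0,
      forall (a : R) x, N (a *: x) = `|a| * N x &
      forall x y, N (x + y) <= N x + N y].

(** [X], together with [iota], is a completion of the normed space [(V, N)];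
    this determines [X] up to a unique isometric isomorphism under [V]. *)
Definition is_completion (R : realType) (V : lmodType R) (N : V -> R)
    (X : completeNormedModType R) (iota : {linear V -> X}) : Prop :=
  (forall x, `|iota x| = N x) /\ dense (range iota).

Definition is_schlumprecht_space (R : realType) (X : completeNormedModType R) :
    Prop :=
  exists (N : c00 R -> R) (iota : {linear c00 R -> X}),
    [/\ is_norm N, schlumprecht_equation N & is_completion N iota].

Section Subspaces.
Context {R : realType}.

Definition closed_subspace (X : normedModType R) (Y : set X) : Prop :=
  submod_closed [in Y] /\ closed Y.

Definition finite_dimensional (X : lmodType R) (Y : set X) : Prop :=
  exists (n : nat) (v : 'I_n -> X),
    forall y, Y y -> exists c : 'I_n -> R, y = \sum_(i < n) c i *: v i.

(** [U] is the inverse of [T]; its values outside [Z] are irrelevant. *)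
Definition isomorphic_to_subspace (W X : normedModType R) (Z : set X) : Prop :=
  exists (T : {linear W -> X}) (U : X -> W),
    [/\ range T = Z, cancel T U, continuous T & {within Z, continuous U}].

Definition complemented (X : normedModType R) (Z : set X) : Prop :=
  exists P : {linear X -> X},
    [/\ continuous P, forall x, P (P x) = P x & range P = Z].

Definition complementably_minimal (X : completeNormedModType R) : Prop :=
  forall Y : set X, closed_subspace Y -> ~ finite_dimensional Y ->
    exists Z : set X,
      [/\ Z `<=` Y, closed_subspace Z, isomorphic_to_subspace X Z &
          complemented Z].

End Subspaces.

(* Main.v *)
(** In a subspace we find almost-blocks [z_i] close to averages [y_i] of [n_i]
    successive vectors of norm at most 1, with [N y_i >= 1/2] and [n_i] growing
    very fast; such averages exist since otherwise iterating them would give a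
    norm at most [(n/2)^k] to the sum of [n^k] blocks, against the lower bound
    [n^k / f (n^k)].  The claim is that [e_i |-> y_i] is bounded.  Since the norm
    is computed by trees whose nodes of arity [l] carry the weight [1 / f l],
    follow a norming tree of [sum_i a_i y_i].
    - A node of arity [l] much smaller than [n_i] cuts few of the [n_i] atoms of
      [y_i], so [y_i] is shared between the children like a convex combination,
      and by linearity may be attributed to a single child.
    - For [i] below the first index with [n_i] much larger than [l], all terms but
      the last are negligible, and that last one (the only bad index of the node)
      is replaced by the full coordinate [a_i].
    Hence [sum_i a_i y_i] is estimated by trees on the basis in which a node of
    very large arity [l] may pick one additional coordinate, to the left of
    everything else below the node.  These enlarged trees give an equivalent norm:
    a forest of [n] of them is bounded by [(1 + O (f n ^ (-1/2))) f n N x], the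
    error being paid by the choice of [l], and along a branch the additional
    coordinates are distinct, so that the product of the constants converges.
    Norming functionals of the [y_i] give a left inverse [Q] of [e_i |-> y_i], and
    perturbing [y_i] to [z_i] keeps [Q T] invertible, which yields the projection
    [T (Q T)^-1 Q]. *)
Require Import Defs.
From HB Require Import structures.
From mathcomp Require Import all_boot all_order all_algebra.
From mathcomp Require Import all_classical all_reals all_analysis.
From mathcomp Require Import ring lra zify.

Set Implicit Arguments.
Unset Strict Implicit.
Unset Printing Implicit Defensive.

Import Order.TTheory GRing.Theory Num.Theory.
Import numFieldNormedType.Exports.

Local Open Scope classical_set_scope.
Local Open Scope ring_scope.

(** * Trees *)

(** [Node s] stands for [1 / f (size s)] times the sum of the functionals in [s],
    and [Bad i s] for the same functional plus the coordinate [i]. *)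
Inductive tree : Type :=
| Zero
| Leaf of nat
| Node of seq tree
| Bad of nat & seq tree.

HB.instance Definition _ := gen_eqMixin tree.
HB.instance Definition _ := gen_choiceMixin tree.

Section TreeInd.
Variable P : tree -> Prop.
Hypothesis P0 : P Zero.
Hypothesis PL : forall i, P (Leaf i).
Hypothesis PN : forall s, (forall t, t \in s -> P t) -> P (Node s).
Hypothesis PB : forall i s, (forall t, t \in s -> P t) -> P (Bad i s).

Fixpoint tree_seq_ind (t : tree) : P t :=
  let aux := fix aux (s : seq tree) : forall u, u \in s -> P u :=
    match s as s return forall u, u \in s -> P u with
    | [::] => fun u h => False_ind _ (eq_ind false (fun b : bool => if b then False else True) I _ h)
    | v :: s' => fun u h =>
      match @orP (u == v) (u \in s') h with
      | or_introl e => ecast z (P z) (esym (eqP e)) (tree_seq_ind v)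
      | or_intror h' => aux s' u h'
      end
    end in
  match t with
  | Zero => P0
  | Leaf i => PL i
  | Node s => PN (aux s)
  | Bad i s => PB i (aux s)
  end.
End TreeInd.

Fixpoint leaves (t : tree) : seq nat :=
  match t with
  | Zero => [::]
  | Leaf i => [:: i]
  | Node s => flatten (map leaves s)
  | Bad i s => i :: flatten (map leaves s)
  end.

Definition forest_leaves (s : seq tree) : seq nat := flatten (map leaves s).

Fixpoint tree_size (t : tree) : nat :=
  match t with
  | Zero => 1
  | Leaf i => 1
  | Node s => (sumn (map tree_size s)).+1
  | Bad i s => (sumn (map tree_size s)).+1
  end.

Definition forest_size (s : seq tree) := sumn (map tree_size s).

(** This one condition on the leaves encodes that the children of every node have successive
    supports, and for [Bad i s] also that [i] lies to the left of everything below. *)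
Definition succ_tree t := sorted ltn (leaves t).
Definition succ_forest s := sorted ltn (forest_leaves s).

Fixpoint pure (t : tree) : bool :=
  match t with
  | Zero => true
  | Leaf i => true
  | Node s => (1 < size s)%N && all pure s
  | Bad i s => false
  end.

Fixpoint admissible (L : nat -> nat) (t : tree) : bool :=
  match t with
  | Zero => true
  | Leaf i => true
  | Node s => (1 < size s)%N && all (admissible L) s
  | Bad i s => (L i < size s)%N && all (admissible L) s
  end.

(** Discarded leaves become [Zero] instead of disappearing, so that all arities, and hence all
    weights, stay the same. *)
Fixpoint tree_restr (F : pred nat) (t : tree) : tree :=
  match t with
  | Zero => Zero
  | Leaf i => if F i then Leaf i else Zero
  | Node s => Node (map (tree_restr F) s)
  | Bad i s => if F i then Bad i (map (tree_restr F) s)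
               else Node (map (tree_restr F) s)
  end.

Fixpoint tree_subst (T : nat -> tree) (t : tree) : tree :=
  match t with
  | Zero => Zero
  | Leaf i => T i
  | Node s => Node (map (tree_subst T) s)
  | Bad i s => Bad i (map (tree_subst T) s)
  end.

Lemma leaves_restr F t : leaves (tree_restr F t) = [seq i <- leaves t | F i].
Proof.
elim/tree_seq_ind: t => [|i|s IH|i s IH] //=; first by case: (F i).
  rewrite -map_comp filter_flatten -map_comp; congr flatten.
  by apply/eq_in_map => t /IH.
have E : flatten (map leaves (map (tree_restr F) s)) =
    [seq i <- flatten (map leaves s) | F i].
  rewrite -map_comp filter_flatten -map_comp; congr flatten.
  by apply/eq_in_map => t /IH.
by case: (F i) => /=; rewrite E.
Qed.

Lemma succ_restr F t : succ_tree t -> succ_tree (tree_restr F t).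
Proof. by rewrite /succ_tree leaves_restr; apply: sorted_filter; exact: ltn_trans. Qed.

Lemma pure_restr F t : pure t -> pure (tree_restr F t).
Proof.
elim/tree_seq_ind: t => [|i|s IH|i s IH] //=; first by case: (F i).
rewrite size_map => /andP[-> /allP sp] /=.
by apply/allP => _ /mapP[t ts ->]; apply: IH => //; apply: sp.
Qed.

Lemma admissible_restr L F t : (forall i, 0 < L i)%N ->
  admissible L t -> admissible L (tree_restr F t).
Proof.
move=> L0; elim/tree_seq_ind: t => [|i|s IH|i s IH] //=; first by case: (F i).
  rewrite size_map => /andP[-> /allP sp] /=.
  by apply/allP => _ /mapP[t ts ->]; apply: IH => //; apply: sp.
move=> /andP[ls /allP sp].
have h : all (admissible L) (map (tree_restr F) s).
  by apply/allP => _ /mapP[t ts ->]; apply: IH => //; apply: sp.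
(* A [Bad] node that loses its coordinate turns into a [Node], whose arity must exceed 1; this
   follows from [L i < size s] because [L i] is positive. *)
case: (F i) => /=; rewrite size_map h andbT //.
exact: leq_ltn_trans (L0 i) ls.
Qed.

Lemma pure_subst T t : pure t -> (forall i, pure (T i)) -> pure (tree_subst T t).
Proof.
move=> + hT; elim/tree_seq_ind: t => [|i|s IH|i s IH] //=.
rewrite size_map => /andP[-> /allP sp] /=.
by apply/allP => _ /mapP[t ts ->]; apply: IH => //; apply: sp.
Qed.

Lemma leaves_subst T t : pure t ->
  leaves (tree_subst T t) = flatten (map (leaves \o T) (leaves t)).
Proof.
elim/tree_seq_ind: t => [|i|s IH|i s IH] //=; first by rewrite cats0.
move=> /andP[_ /allP sp].
elim: s IH sp => [|t s IHs] //= IH sp.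
rewrite map_cat flatten_cat IH ?mem_head ?sp ?mem_head // IHs // => u us.
  by apply: IH; rewrite in_cons us orbT.
by apply: sp; rewrite in_cons us orbT.
Qed.

Lemma sorted_flattenP (ss : seq (seq nat)) :
  sorted ltn (flatten ss) <->
  (forall j, (j < size ss)%N -> sorted ltn (nth [::] ss j)) /\
  (forall j k, (j < k < size ss)%N ->
     forall a b, a \in nth [::] ss j -> b \in nth [::] ss k -> (a < b)%N).
Proof.
rewrite (sorted_pairwise ltn_trans).
elim: ss => [|s ss IH] /=.
  by split=> // _; split=> // j k /andP[].
rewrite pairwise_cat -!(sorted_pairwise ltn_trans); split.
- move=> /and3P[/allrelP h1 h2]; rewrite sorted_pairwise ?IH; last exact: ltn_trans.
  move=> [h3 h4]; split.
    by case=> [|j] //= js; apply: h3.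
  case=> [|j] [|k] //=; last by rewrite ltnS; apply: h4.
  rewrite ltnS => ks a b ha hb; apply: h1 => //.
  by apply/flattenP; exists (nth [::] ss k) => //; apply: mem_nth.
- move=> [h1 h2]; apply/and3P; split.
  + apply/allrelP => a b ha /flattenP[u /(nthP [::])[k ks <-] hb].
    by apply: (h2 0%N k.+1) => //=.
  + exact: (h1 0%N).
  + rewrite sorted_pairwise ?IH; last exact: ltn_trans.
    split=> [j js|j k jk]; first exact: (h1 j.+1).
    exact: (h2 j.+1 k.+1).
Qed.

Lemma succ_forestP s :
  succ_forest s <->
  (forall j, (j < size s)%N -> succ_tree (nth Zero s j)) /\
  (forall j k, (j < k < size s)%N ->
     forall a b, a \in leaves (nth Zero s j) -> b \in leaves (nth Zero s k) -> (a < b)%N).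
Proof.
rewrite /succ_forest /forest_leaves sorted_flattenP size_map; split=> -[h1 h2]; split.
- by move=> j js; rewrite /succ_tree -(nth_map _ [::]) //; apply: h1.
- move=> j k /andP[jk ks] a b; rewrite -!(nth_map _ [::]) //; last exact: ltn_trans ks.
  by apply: h2; rewrite jk.
- by move=> j js; rewrite (nth_map Zero) //; apply: h1.
- move=> j k /andP[jk ks] a b; rewrite !(nth_map Zero) //; last exact: ltn_trans ks.
  by apply: h2; rewrite jk.
Qed.

Lemma succ_forest_tree s t : succ_forest s -> t \in s -> succ_tree t.
Proof. by move=> /succ_forestP[h _] /(nthP Zero)[j js <-]; apply: h. Qed.

Lemma mem_forest_leaves s i :
  reflect (exists2 t, t \in s & i \in leaves t) (i \in forest_leaves s).
Proof. exact: flatten_mapP. Qed.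

Lemma succ_node s : succ_tree (Node s) = succ_forest s. Proof. by []. Qed.

Lemma succ_bad i s : succ_tree (Bad i s) ->
  succ_forest s /\ (forall j, j \in forest_leaves s -> (i < j)%N).
Proof.
rewrite /succ_tree /= (path_sortedE ltn_trans) => /andP[/allP h1 h2].
by split.
Qed.

(** * Values of trees and the weight function *)

Section Eval.
Variable R : realType.
Local Notation f := (@schlumprecht_f R).
Implicit Types (b : nat -> R) (t : tree).

(** The sum over the children is a [foldr] to keep the recursion structural; [eval_node] and
    [eval_bad] restate it with [eval_forest]. *)
Fixpoint teval (t : tree) (b : nat -> R) : R :=
  match t with
  | Zero => 0
  | Leaf i => b i
  | Node s => (f (size s))^-1 * foldr (fun t acc => teval t b + acc) 0 s
  | Bad i s => b i + (f (size s))^-1 * foldr (fun t acc => teval t b + acc) 0 s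
  end.

Definition eval_forest (s : seq tree) b := \sum_(t <- s) teval t b.

Lemma foldr_eval s b : foldr (fun t acc => teval t b + acc) 0 s = eval_forest s b.
Proof.
by rewrite /eval_forest; elim: s => [|t s IH] /=; rewrite ?big_nil ?big_cons ?IH.
Qed.

Lemma eval_node s b : teval (Node s) b = (f (size s))^-1 * eval_forest s b.
Proof. by rewrite /= foldr_eval. Qed.

Lemma eval_bad i s b :
  teval (Bad i s) b = b i + (f (size s))^-1 * eval_forest s b.
Proof. by rewrite /= foldr_eval. Qed.

Lemma ln_mono (x y : R) : 0 < x -> x <= y -> ln x <= ln y.
Proof.
move=> x0 xy; have y0 := lt_le_trans x0 xy.
by have /= -> := @ler_ln R x y x0 y0.
Qed.

Lemma ln2_gt0 : 0 < ln 2 :> R. Proof. by rewrite ln_gt0 // ltr1n. Qed.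

Lemma f_ge0 n : 0 <= f n.
Proof.
rewrite /schlumprecht_f divr_ge0 ?ln_ge0 ?ler1n //.
Qed.

Lemma f_gt0 n : (0 < n)%N -> 0 < f n.
Proof. by move=> n0; rewrite /schlumprecht_f divr_gt0 ?ln2_gt0 // ln_gt0 // ltr1n ltnS. Qed.

Lemma f_le m n : (m <= n)%N -> f m <= f n.
Proof.
move=> mn; rewrite /schlumprecht_f ler_wpM2r ?invr_ge0 ?(ltW ln2_gt0) //.
by rewrite ln_mono ?ltr0n // ler_nat ltnS.
Qed.

Lemma f1 : f 1 = 1.
Proof. by rewrite /schlumprecht_f divff // gt_eqF // ln2_gt0. Qed.

(** After taking logarithms this is [8 <= 9]. It makes every level of a tree contract by the factor
    [2 / 3], which drives [N_le_trees] and [split_error_step]. *)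
Lemma f2_ge : 3 / 2 <= f 2.
Proof.
rewrite /schlumprecht_f ler_pdivlMr ?ln2_gt0 //.
have h : 3 * ln 2 <= 2 * ln 3 :> R.
  have e1 : 3 * ln 2 = ln (2 ^+ 3) :> R by rewrite lnXn ?ltr0n // mulr_natl.
  have e2 : 2 * ln 3 = ln (3 ^+ 2) :> R by rewrite lnXn ?ltr0n // mulr_natl.
  by rewrite e1 e2 ln_mono ?exprn_gt0 ?ltr0n // -!natrX ler_nat.
lra.
Qed.

Lemma f_ge32 n : (1 < n)%N -> 3 / 2 <= f n.
Proof. by move=> n1; exact: le_trans f2_ge (f_le n1). Qed.

Lemma eval_ext t b b' : {in leaves t, b =1 b'} -> teval t b = teval t b'.
Proof.
elim/tree_seq_ind: t => [|i|s IH|i s IH] h //.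
- by rewrite /= h ?mem_head.
- rewrite !eval_node; congr (_ * _); apply: eq_big_seq => t ts; apply: IH => //.
  by move=> i it; apply: h; apply/flatten_mapP; exists t.
- rewrite !eval_bad h ?mem_head //; congr (_ + _ * _).
  apply: eq_big_seq => t ts; apply: IH => //.
  by move=> j jt; apply: h; rewrite in_cons; apply/orP; right; apply/flatten_mapP; exists t.
Qed.

Lemma eval_le t b b' : {in leaves t, forall i, b i <= b' i} -> teval t b <= teval t b'.
Proof.
elim/tree_seq_ind: t => [|i|s IH|i s IH] h //.
- by rewrite /= h ?mem_head.
- rewrite !eval_node ler_wpM2l ?invr_ge0 ?f_ge0 // /eval_forest big_seq [leRHS]big_seq.
  apply: ler_sum => t ts; apply: IH => //.
  by move=> i it; apply: h; apply/flatten_mapP; exists t.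
- rewrite !eval_bad lerD ?h ?mem_head //.
  rewrite ler_wpM2l ?invr_ge0 ?f_ge0 // /eval_forest big_seq [leRHS]big_seq.
  apply: ler_sum => t ts; apply: IH => //.
  by move=> j jt; apply: h; rewrite in_cons; apply/orP; right; apply/flatten_mapP; exists t.
Qed.

Lemma eval0 t : teval t (fun=> 0) = 0.
Proof.
elim/tree_seq_ind: t => [|i|s IH|i s IH] //.
- by rewrite eval_node /eval_forest big_seq big1 ?mulr0.
- by rewrite eval_bad /eval_forest big_seq big1 ?mulr0 ?addr0.
Qed.

Lemma eval_ge0 t b : (forall i, 0 <= b i) -> 0 <= teval t b.
Proof. by move=> b0; rewrite -(eval0 t) eval_le. Qed.

Lemma eval_lin t (a : R) b b' :
  teval t (fun i => a * b i + b' i) = a * teval t b + teval t b'.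
Proof.
have forest s : (forall t, t \in s ->
    teval t (fun i => a * b i + b' i) = a * teval t b + teval t b') ->
    eval_forest s (fun i => a * b i + b' i) = a * eval_forest s b + eval_forest s b'.
  move=> IH; rewrite /eval_forest mulr_sumr -big_split /=.
  exact: eq_big_seq.
elim/tree_seq_ind: t => [|i|s IH|i s IH].
- by rewrite /= mulr0 addr0.
- by [].
- by rewrite !eval_node forest //; ring.
- by rewrite !eval_bad forest //; ring.
Qed.

Lemma eval_sum (I : Type) (r : seq I) (P : pred I) (F : I -> nat -> R) t :
  teval t (fun i => \sum_(j <- r | P j) F j i) = \sum_(j <- r | P j) teval t (F j).
Proof.
elim: r => [|j r IH].
  rewrite big_nil -[RHS](eval0 t); apply: eval_ext => i _; by rewrite big_nil.
rewrite big_cons; case: ifP => Pj; rewrite -IH.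
  rewrite -[teval t (F j)]mul1r -eval_lin; apply: eval_ext => i _.
  by rewrite big_cons Pj mul1r.
by apply: eval_ext => i _; rewrite big_cons Pj.
Qed.

Lemma eval_scale (a : R) b t : teval t (fun i => a * b i) = a * teval t b.
Proof.
by rewrite -[RHS]addr0 -[X in _ + X](eval0 t) -eval_lin; apply: eval_ext => i _; rewrite addr0.
Qed.

Lemma eval_restr F t b :
  teval (tree_restr F t) b = teval t (fun i => if F i then b i else 0).
Proof.
have forest s : (forall t, t \in s ->
    teval (tree_restr F t) b = teval t (fun i => if F i then b i else 0)) ->
    eval_forest (map (tree_restr F) s) b =
    eval_forest s (fun i => if F i then b i else 0).
  by move=> IH; rewrite /eval_forest big_map; exact: eq_big_seq.
elim/tree_seq_ind: t => [|i|s IH|i s IH] //.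
- by rewrite /=; case: (F i).
- by rewrite [tree_restr _ _]/= !eval_node size_map forest.
- rewrite [tree_restr _ _]/=; case: ifP => Fi.
    by rewrite !eval_bad Fi size_map forest.
  by rewrite eval_bad Fi eval_node size_map forest // add0r.
Qed.

Lemma eval_subst T t b : pure t ->
  teval (tree_subst T t) b = teval t (fun i => teval (T i) b).
Proof.
elim/tree_seq_ind: t => [|i|s IH|i s IH] //.
move=> /andP[_ /allP sp]; rewrite [tree_subst _ _]/= !eval_node size_map.
congr (_ * _); rewrite /eval_forest big_map; apply: eq_big_seq => t ts.
by apply: IH => //; apply: sp.
Qed.

Lemma f_ge1 n : (0 < n)%N -> 1 <= f n.
Proof. by move=> n0; rewrite -f1 f_le. Qed.

Lemma f_inv_le1 n : (f n)^-1 <= 1.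
Proof.
case: n => [|n]; first by rewrite /schlumprecht_f ln1 mul0r invr0.
by rewrite invf_le1 ?f_gt0 // f_ge1.
Qed.

Lemma eval_le_leaves t b : (forall i, 0 <= b i) ->
  teval t b <= \sum_(i <- leaves t) b i.
Proof.
move=> b0.
have forest s : (forall t, t \in s -> teval t b <= \sum_(i <- leaves t) b i) ->
    (f (size s))^-1 * eval_forest s b <= \sum_(i <- flatten (map leaves s)) b i.
  move=> IH; rewrite big_flatten /= big_map.
  apply: (@le_trans _ _ (eval_forest s b)).
    rewrite ler_piMl ?f_inv_le1 // /eval_forest sumr_ge0 // => u _.
    exact: eval_ge0.
  by rewrite /eval_forest big_seq [leRHS]big_seq; apply: ler_sum.
elim/tree_seq_ind: t => [|i|s IH|i s IH].
- by rewrite big_nil.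
- by rewrite big_seq1.
- by rewrite eval_node forest.
- by rewrite eval_bad /= big_cons lerD2l forest.
Qed.

End Eval.

(** * The norm in terms of trees *)

Section NormTrees.
Variable R : realType.
Local Notation f := (@schlumprecht_f R).
Variable N : c00 R -> R.
Hypothesis normN : is_norm N.
Hypothesis eqnN : schlumprecht_equation N.
Implicit Types (x y : c00 R) (t : tree) (s : seq tree).

Definition absf (x : nat -> R) : nat -> R := fun i => `|x i|.

Lemma absf_ge0 (x : nat -> R) i : 0 <= absf x i. Proof. exact: normr_ge0. Qed.

Lemma c00_ext x y : (forall i, x i = y i) -> x = y.
Proof. by move=> h; apply/val_inj/funext. Qed.

Lemma c00_bound x : exists M, forall i, (M <= i)%N -> x i = 0.
Proof.
have /asboolP /finite_setP[n /=] := c00_fin x.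
rewrite card_eq_sym => /pcard_eqP/bijPex[g] /= [_ _ gs].
have [F hF] : exists F : seq nat, forall i, x i != 0 -> i \in F.
  exists [seq g k | k <- iota 0 n] => i xi.
  have [k kn <-] := gs i xi.
  by apply: map_f; rewrite mem_iota.
exists (\max_(k <- F) k).+1 => i Mi; apply/eqP/negP => /negP /hF iF.
have := @leq_bigmax_seq _ F xpredT (fun k => k) i iF isT.
by rewrite leqNgt (leq_trans _ Mi).
Qed.

Lemma N0 : N 0 = 0.
Proof. by case: normN => _ h _; rewrite -(scale0r (0 : c00 R)) h normr0 mul0r. Qed.

Lemma N_ge0 x : 0 <= N x.
Proof.
case: normN => _ h tri; have := tri x (- x).
rewrite subrr N0 -scaleN1r h normrN1 mul1r; lra.
Qed.

Lemma N_coord x i : `|x i| <= N x.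
Proof.
rewrite -lee_fin eqnN le_max; apply/orP; left.
by apply: ereal_sup_ubound; exists i.
Qed.

Lemma N_chain x n (E : 'I_n -> set nat) : (1 < n)%N ->
  (forall i j : 'I_n, (i < j)%N -> set_lt (E i) (E j)) ->
  \sum_(i < n) N (restr (E i) x) <= f n * N x.
Proof.
move=> n1 hE; have fn0 : 0 < f n by apply: f_gt0; lia.
rewrite -ler_pdivrMl //.
rewrite -lee_fin (eqnN x) le_max; apply/orP; right.
by apply: ereal_sup_ubound; exists n, E.
Qed.

Lemma N_le x c : (forall i, `|x i| <= c) ->
  (forall n (E : 'I_n -> set nat), (1 < n)%N ->
     (forall i j : 'I_n, (i < j)%N -> set_lt (E i) (E j)) ->
     (f n)^-1 * \sum_(i < n) N (restr (E i) x) <= c) ->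
  N x <= c.
Proof.
move=> h1 h2; rewrite -lee_fin eqnN ge_max; apply/andP; split.
  by apply: ge_ereal_sup => _ [i _ <-]; rewrite lee_fin.
apply: ge_ereal_sup => _ [n [E [n2 hE ->]]]; rewrite lee_fin.
exact: h2.
Qed.

Lemma restr_leaves_eval t x :
  teval t (absf x) = teval t (absf (restr [set i | i \in leaves t] x)).
Proof.
apply: eval_ext => i it; rewrite /absf /= /restr_fun.
by rewrite mem_set.
Qed.

(** [set_lt] demands nonempty sets, so children without leaves are dropped before the norm equation
    is applied; the monotonicity of [f] absorbs the smaller arity. *)
Lemma filter_leaves s : forest_leaves [seq t <- s | leaves t != [::]] = forest_leaves s.
Proof.
rewrite /forest_leaves; elim: s => [|t s IH] //=.
by case: eqVneq => [->|] //=; rewrite IH.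
Qed.

Lemma filter_eval s b :
  eval_forest (R := R) [seq t <- s | leaves t != [::]] b = eval_forest s b.
Proof.
rewrite /eval_forest big_filter [RHS](bigID (fun t => leaves t != [::])) /=.
rewrite [X in _ + X]big1 ?addr0 // => t /negbNE /eqP h.
by rewrite -(eval0 R t); apply: eval_ext => i; rewrite h.
Qed.

Lemma N_forest s x : (1 < size s)%N -> succ_forest s ->
  (forall t, t \in s -> leaves t != [::]) ->
  \sum_(t <- s) N (restr [set i | i \in leaves t] x) <= f (size s) * N x.
Proof.
move=> s1 hs ne; rewrite (big_nth Zero) big_mkord.
apply: (@N_chain x _ (fun j : 'I_(size s) => [set i | i \in leaves (nth Zero s j)])) => //.
have /succ_forestP[_ h] := hs.
have nonempty (j : 'I_(size s)) : [set i | i \in leaves (nth Zero s j)] !=set0.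
  have := ne _ (mem_nth Zero (ltn_ord j)).
  by case E : (leaves (nth Zero s j)) => [|a l] // _; exists a => /=; rewrite mem_head.
move=> i j ij; split=> // a b /= ha hb.
by apply: (h i j) => //; rewrite ij /=.
Qed.

Lemma eval_le_N t x : pure t -> succ_tree t -> teval t (absf x) <= N x.
Proof.
elim/tree_seq_ind: t x => [|i|s IH|i s IH] x //.
- by rewrite /= => _ _; exact: N_ge0.
- by move=> _ _; exact: N_coord.
move=> /andP[s1 /allP ps]; rewrite succ_node => ss.
rewrite eval_node -filter_eval.
set s' := [seq t <- s | leaves t != [::]].
have ss' : succ_forest s' by rewrite /succ_forest filter_leaves.
have s's : (size s' <= size s)%N by rewrite size_filter count_size.
have IH' t y : t \in s' -> teval t (absf y) <= N y.
  rewrite mem_filter => /andP[_ ts]; apply: IH => //; first exact: ps.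
  exact: succ_forest_tree ss ts.
have fs : 0 < f (size s) by apply: f_gt0; exact: ltnW.
rewrite ler_pdivrMl //.
have [s'1|] := ltnP 1 (size s').
  apply: le_trans (_ : f (size s') * N x <= _); last by rewrite ler_wpM2r ?N_ge0 // f_le.
  apply: le_trans (N_forest x s'1 ss' _); last by move=> t; rewrite mem_filter => /andP[].
  rewrite /eval_forest big_seq [leRHS]big_seq; apply: ler_sum => t ts.
  by rewrite restr_leaves_eval IH'.
case E : s' => [|t [|]] // _; rewrite /eval_forest ?big_nil ?big_seq1.
  by rewrite mulr_ge0 ?N_ge0 // ltW.
apply: le_trans (IH' _ _ _) _; first by rewrite E mem_head.
by rewrite ler_peMl ?N_ge0 // f_ge1 //; exact: ltnW.
Qed.

Lemma restr_out E x : (forall i, E i -> x i = 0) -> restr E x = 0.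
Proof.
move=> h; apply: c00_ext => i; rewrite /= /restr_fun.
by case: ifPn => // /set_mem /h ->.
Qed.

Lemma restr_in E x : (forall i, x i != 0 -> E i) -> restr E x = x.
Proof.
move=> h; apply: c00_ext => i; rewrite /= /restr_fun.
case: ifPn => // iE; apply/eqP; rewrite eq_sym; apply/negP => /negP /h.
by move/mem_set; rewrite (negbTE iE).
Qed.

Lemma succ_map_restr n (E : 'I_n -> set nat) (g : 'I_n -> tree) :
  (forall i j : 'I_n, (i < j)%N -> set_lt (E i) (E j)) ->
  (forall i, succ_tree (g i)) ->
  succ_forest [seq tree_restr (fun k => k \in E j) (g j) | j <- enum 'I_n].
Proof.
move=> hE hg; apply/succ_forestP; rewrite size_map size_enum_ord; split=> [j jn|j k /andP[jk kn]].
  rewrite (nth_map (Ordinal jn)) ?size_enum_ord //.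
  exact: succ_restr.
have jn := ltn_trans jk kn.
rewrite (nth_map (Ordinal jn)) ?size_enum_ord // (nth_map (Ordinal kn)) ?size_enum_ord //.
move=> a b; rewrite !leaves_restr !mem_filter.
move=> /andP[/set_mem ha _] /andP[/set_mem hb _].
have [_ _] := hE (Ordinal jn) (Ordinal kn) jk; apply.
  by rewrite (_ : Ordinal jn = nth (Ordinal jn) (enum 'I_n) j) //; apply: val_inj; rewrite /= nth_enum_ord.
by rewrite (_ : Ordinal kn = nth (Ordinal kn) (enum 'I_n) k) //; apply: val_inj; rewrite /= nth_enum_ord.
Qed.

(** Induction on the size of the support. If no set of a chain contains the whole support, every
    piece has a smaller support, and nearly norming trees of the pieces are joined under one node.
    If some set contains the whole support, the chain yields at most [2 / 3 * N x], which [N x]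
    absorbs. *)
Lemma N_le_trees x c :
  (forall t, pure t -> succ_tree t -> teval t (absf x) <= c) -> N x <= c.
Proof.
have [M hM] := c00_bound x.
have [m] := ubnP (\sum_(i < M) (x i != 0%R))%N.
elim: m x hM c => // m IH x hM c xm hc.
have c0 : 0 <= c by have := hc Zero isT isT.
have : N x <= Num.max c (2 / 3 * N x).
  apply: N_le => [i|n E n1 hE].
    by rewrite le_max; apply/orP; left; exact: (hc (Leaf i)).
  have fn : 3 / 2 <= f n := f_ge32 R n1.
  have fn0 : 0 < f n by lra.
  have fni : (f n)^-1 <= 2 / 3.
    by rewrite -[2 / 3]invrK lef_pV2 ?posrE ?invr_gt0; lra.
  have [[j hj]|small] := pselect (exists j, forall i, x i != 0 -> E j i).
    rewrite (bigD1 j) //= big1 => [|k kj].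
      rewrite addr0 restr_in // le_max; apply/orP; right.
      by rewrite ler_wpM2r ?N_ge0.
    rewrite restr_out ?N0 // => i Eki; apply/eqP/negP => /negP /hj Eji.
    have [jk|kj'|e] := ltngtP j k.
    - by have [_ _ h] := hE _ _ jk; have := h _ _ Eji Eki; rewrite ltnn.
    - by have [_ _ h] := hE _ _ kj'; have := h _ _ Eki Eji; rewrite ltnn.
    - by move/eqP: kj; apply; apply: val_inj.
  rewrite le_max; apply/orP; left.
  apply/ler_addgt0Pr => e e0.
  have ht j : exists t, [/\ pure t, succ_tree t &
      N (restr (E j) x) - e / n%:R <= teval t (absf (restr (E j) x))].
    apply: contrapT => hn.
    have : N (restr (E j) x) <= N (restr (E j) x) - e / n%:R.
      apply: IH => [i Mi||t pt st].
      - by rewrite /= /restr_fun hM // if_same.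
      - rewrite -ltnS; apply: leq_trans xm; rewrite ltnS.
        have [i [xi Eji]] : exists i, x i != 0 /\ ~ E j i.
          apply: contrapT => hh; apply: small; exists j => i xi.
          by apply: contrapT => Eji; apply: hh; exists i.
        have iM : (i < M)%N by rewrite ltnNge; apply: contra_neqN xi => /hM.
        rewrite (bigD1 (Ordinal iM)) //= [X in (_ < X)%N](bigD1 (Ordinal iM)) //= xi.
        rewrite /restr_fun memNset // eqxx add0n add1n ltnS.
        by apply: leq_sum => k _; case: ifP => //; rewrite eqxx.
      - by rewrite leNgt; apply/negP => h; apply: hn; exists t; split=> //; exact: ltW.
    have : 0 < e / n%:R by rewrite divr_gt0 // ltr0n; lia.
    lra.
  have [g hg] := choice ht.
  set s := [seq tree_restr (fun k => k \in E j) (g j) | j <- enum 'I_n].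
  have sn : size s = n by rewrite size_map size_enum_ord.
  have := hc (Node s) _ _; rewrite eval_node sn => h.
  have {}h : (f n)^-1 * eval_forest s (absf x) <= c.
    apply: h.
      rewrite /= sn n1; apply/allP => _ /mapP[j _ ->].
      by apply: pure_restr; case: (hg j).
    by rewrite succ_node; apply: succ_map_restr => // i; case: (hg i).
  apply: (@le_trans _ _ ((f n)^-1 * (eval_forest s (absf x) + e))).
    rewrite ler_wpM2l ?invr_ge0 ?(ltW fn0) //.
    rewrite /eval_forest big_map big_enum /=.
    have -> : e = \sum_(j < n) (e / n%:R).
      by rewrite sumr_const card_ord -[RHS]mulr_natr divfK // pnatr_eq0; lia.
    rewrite -big_split /=; apply: ler_sum => j _.
    have [_ _] := hg j; rewrite eval_restr lerBlDr.
    move=> hj; apply: le_trans hj _; rewrite lerD2r.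
    apply: eval_le => i _; rewrite /absf /= /restr_fun.
    by case: ifP; rewrite ?normr0.
  rewrite mulrDr; apply: lerD => //.
  by rewrite ler_piMl ?(ltW e0) // f_inv_le1.
by rewrite le_max => /orP[//|]; have := N_ge0 x; lra.
Qed.

Lemma N_mono x y : (forall i, `|x i| <= `|y i|) -> N x <= N y.
Proof.
move=> h; apply: N_le_trees => t pt st; apply: le_trans (eval_le_N y pt st).
by apply: eval_le => i _; exact: h.
Qed.

Lemma N_restr E x : N (restr E x) <= N x.
Proof.
by apply: N_mono => i; rewrite /= /restr_fun; case: ifP; rewrite ?normr0.
Qed.

(** A form of [N_chain] that admits empty pieces and a single piece: empty ones are dropped, and a
    lone piece is bounded by monotonicity of the norm and [f >= 1]. *)
Lemma N_pieces (ls : seq (seq nat)) x : (0 < size ls)%N -> sorted ltn (flatten ls) ->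
  \sum_(l <- ls) N (restr [set i | i \in l] x) <= f (size ls) * N x.
Proof.
move=> ls0 sls.
pose ls' := [seq l <- ls | l != [::]].
have e : flatten ls' = flatten ls.
  by rewrite /ls'; elim: (ls) => [|[|a l] r IH] //=; rewrite IH.
have -> : \sum_(l <- ls) N (restr [set i | i \in l] x) =
    \sum_(l <- ls') N (restr [set i | i \in l] x).
  rewrite big_filter [LHS](bigID (fun l => l != [::])) /=.
  rewrite [X in _ + X]big1 ?addr0 // => l /negbNE /eqP ->.
  by rewrite restr_out ?N0.
have size' : (size ls' <= size ls)%N by rewrite size_filter count_size.
have ne l : l \in ls' -> l != [::] by rewrite mem_filter => /andP[].
move: sls; rewrite -e; move: size' ne; clearbody ls' => {e}.
case: ls' => [|l [|l' r]] hs ne sls.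
- by rewrite big_nil mulr_ge0 ?f_ge0 ?N_ge0.
- rewrite big_seq1; apply: le_trans (N_restr _ _) _.
  by rewrite ler_peMl ?N_ge0 // f_ge1.
set ls' := [:: l, l' & r] in hs ne sls *.
apply: (@le_trans _ _ (f (size ls') * N x)); last first.
  by rewrite ler_wpM2r ?N_ge0 // f_le.
rewrite (big_nth [::]) big_mkord.
have /sorted_flattenP[_ h] := sls.
apply: (@N_chain x _ (fun j : 'I_(size ls') => [set i | i \in nth [::] ls' j])) => //.
have nonempty (j : 'I_(size ls')) : [set i | i \in nth [::] ls' j] !=set0.
  have := ne _ (mem_nth [::] (ltn_ord j)).
  by case E : (nth [::] ls' j) => [|a m] // _; exists a => /=; rewrite mem_head.
by move=> i j ij; split=> // a b /= ha hb; apply: (h i j) => //; rewrite ij /=.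
Qed.

End NormTrees.

(** * Trees with additional coordinates *)

Definition children (t : tree) : seq tree :=
  match t with Node u => u | Bad _ u => u | _ => [::] end.

Definition is_node (t : tree) : bool := if t is Node _ then true else false.

Definition expand (p : pred tree) (s : seq tree) : seq tree :=
  flatten [seq (if p t then children t else [:: t]) | t <- s].

Lemma expand_cons p t s :
  expand p (t :: s) = (if p t then children t else [:: t]) ++ expand p s.
Proof. by []. Qed.

Lemma forest_leaves_cat s s' :
  forest_leaves (s ++ s') = forest_leaves s ++ forest_leaves s'.
Proof. by rewrite /forest_leaves map_cat flatten_cat. Qed.

Lemma expand_leaves (p : pred tree) s : (forall t, p t -> is_node t) ->
  forest_leaves (expand p s) = forest_leaves s.
Proof.
move=> pn; elim: s => [|t s IH] //; rewrite expand_cons forest_leaves_cat IH.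
case: ifP => [/pn|_]; first by case: t.
by rewrite /forest_leaves /= cats0.
Qed.

Lemma expand_admissible L (p : pred tree) s : (forall t, p t -> is_node t) ->
  all (admissible L) s -> all (admissible L) (expand p s).
Proof.
move=> pn; elim: s => [|t s IH] // /andP[ht /IH hs].
rewrite expand_cons all_cat hs andbT.
case: ifP => [/pn|_]; last by rewrite /= ht.
by case: t ht => //= u /andP[].
Qed.

Lemma forest_size_cat s s' : forest_size (s ++ s') = (forest_size s + forest_size s')%N.
Proof. by rewrite /forest_size map_cat sumn_cat. Qed.

(** Each opened node loses its root, so opening at least one node allows an induction on
    [forest_size]. *)
Lemma expand_size_le (p : pred tree) s : (forall t, p t -> is_node t) ->
  (forest_size (expand p s) + has p s <= forest_size s)%N.
Proof.
move=> pn; elim: s => [|t s IH] //; rewrite expand_cons forest_size_cat [has _ _]/=.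
rewrite -[X in (_ <= X)%N]/(tree_size t + forest_size s)%N.
case: ifP => [|pt]; last by rewrite /= /forest_size /= addn0 -addnA leq_add2l.
move=> /[dup] pt /pn; case: t pt => // u pu _; rewrite /= -/(forest_size u).
lia.
Qed.

Lemma children_size s t : t \in s -> (0 < size (children t))%N ->
  (forest_size (children t) < forest_size s)%N.
Proof.
elim: s => // u s IH; rewrite in_cons -[forest_size (u :: s)]/(tree_size u + forest_size s)%N.
case/orP => [/eqP -> h|/IH h /h]; last by lia.
by apply: leq_trans (leq_addr _ _); case: u h => //= [u|i u]; rewrite -/(forest_size u).
Qed.

(** * Norm estimate for forests with additional coordinates *)

Section ForestEstimate.
Variable R : realType.
Local Notation f := (@schlumprecht_f R).
Variable N : c00 R -> R.
Hypothesis normN : is_norm N.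
Hypothesis eqnN : schlumprecht_equation N.
Variables (L : nat -> nat) (C : nat -> R).

(** The constant 140 is only required to be large in the proof of
    [forest_estimate]. *)
Definition growth (n : nat) : R := f n + Num.min (2 * f n) (140 * Num.sqrt (f n)).

(** [C i] is the constant for forests whose leaves are at least [i]. All leaves below the coordinate
    of a [Bad i] node are beyond [i], so the drop from [C i] to [C i.+1] can pay for the factor
    [growth l / f l] lost at that node. *)
Hypothesis C_ge1 : forall i, 1 <= C i.
Hypothesis C_dec : forall i j, (i <= j)%N -> C j <= C i.
Hypothesis C_growth : forall i l, (L i < l)%N -> C i.+1 * growth l <= C i * f l.

Lemma expand_eval (p : pred tree) s (b : nat -> R) : (forall t, p t -> is_node t) ->
  all (admissible L) s ->
  eval_forest (expand p s) b =
  \sum_(t <- s) (if p t then f (size (children t)) else 1) * teval t b.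
Proof.
move=> pn; elim: s => [|t s IH]; first by rewrite /expand /eval_forest !big_nil.
move=> /andP[ht hs]; rewrite big_cons -IH // expand_cons /eval_forest big_cat /=.
congr (_ + _); case: ifP => [/pn|_]; last by rewrite big_seq1 mul1r.
case: t ht => // u /andP[u1 _] _ /=.
rewrite foldr_eval mulrA mulfV ?mul1r //.
by rewrite gt_eqF // f_gt0 //; exact: ltnW.
Qed.

Lemma f_mul (n n' : nat) (P : R) : 0 <= P ->
  n'.+1%:R <= n.+1%:R * expR (P * ln 2) -> f n' <= f n + P.
Proof.
move=> P0 h; rewrite /schlumprecht_f ler_pdivrMr ?ln2_gt0 // mulrDl divfK ?gt_eqF ?ln2_gt0 //.
apply: le_trans (ln_mono _ h) _; first by rewrite ltr0n.
by rewrite lnM ?posrE ?ltr0n ?expR_gt0 // expRK.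
Qed.

(** An opened node has at most [2 ^ P - 1] children, so the length of the forest grows by a factor
    of at most [2 ^ P], which the logarithm in [f] turns into the summand [P]. *)
Lemma expand_f (p : pred tree) s (P : R) : 0 <= P ->
  (forall t, p t -> f (size (children t)) <= P) -> f (size (expand p s)) <= f (size s) + P.
Proof.
move=> P0 hp; apply: f_mul => //; set e := expR _.
have e1 : 1 <= e by rewrite -expR0 ler_expR mulr_ge0 // ltW // ln2_gt0.
have : (size (expand p s))%:R <= (size s)%:R * e.
  elim: s => [|t s IH]; first by rewrite mul0r.
  rewrite expand_cons size_cat natrD [size (t :: s)]/= -addn1 natrD mulrDl mul1r addrC.
  apply: lerD => //; case: ifP => [/hp h|_] //=.
  apply: (@le_trans _ _ (size (children t)).+1%:R); first by rewrite ler_nat.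
  rewrite -[leLHS]lnK ?posrE ?ltr0n // ler_expR.
  by move: h; rewrite /schlumprecht_f ler_pdivrMr ?ln2_gt0.
move=> h; rewrite -addn1 -[X in X%:R * e]addn1 !natrD mulrDl mul1r.
exact: lerD.
Qed.

Lemma growth_le3 n : growth n <= 3 * f n.
Proof.
rewrite /growth; have : Num.min (2 * f n) (140 * Num.sqrt (f n)) <= 2 * f n.
  by rewrite ge_min lexx.
lra.
Qed.

(** Used with [r ^+ 2] the value of [f] at the length of a forest and [P] the increase caused by
    opening nodes. The square root of [f n] is at most [(r ^+ 2 + P) / r], whether it is below or
    above [r], and this leaves a rational bound in [r]. *)
Lemma growth_le (n : nat) (r P : R) : 0 < r -> 0 <= P -> f n <= r ^+ 2 + P ->
  growth n <= (r ^+ 2 + P) * (1 + 140 / r).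
Proof.
move=> r0 P0 h; have h2 : Num.min (2 * f n) (140 * Num.sqrt (f n)) <= 140 * Num.sqrt (f n).
  by rewrite ge_min lexx orbT.
have h3 : Num.sqrt (f n) <= (r ^+ 2 + P) / r.
  rewrite ler_pdivlMr //.
  have s0 := sqrtr_ge0 (f n).
  have e : Num.sqrt (f n) ^+ 2 = f n by rewrite sqr_sqrtr ?f_ge0.
  have [rs|sr] := leP r (Num.sqrt (f n)).
    by apply: le_trans h; rewrite -[leRHS]e expr2 ler_wpM2l.
  apply: (@le_trans _ _ (r * r)); first by rewrite ler_wpM2r // ltW.
  by rewrite -expr2 lerDl.
rewrite /growth; have : (r ^+ 2 + P) * (1 + 140 / r) = r ^+ 2 + P + 140 * ((r ^+ 2 + P) / r) by ring.
lra.
Qed.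

Lemma eval_forest_restr s (x : c00 R) :
  eval_forest s (absf x) =
  eval_forest s (absf (restr [set i | i \in forest_leaves s] x)).
Proof.
apply: eq_big_seq => t ts; apply: eval_ext => i it.
rewrite /absf /= /restr_fun mem_set //=.
by apply/mem_forest_leaves; exists t.
Qed.

(** Write [r = sqrt (f n)]. If the bound fails, replacing the nodes of weight at
    least [1 / r] (resp. between [1 / (16 r^2)] and [1 / r]) by their children
    gives a slightly longer forest with a much larger value, unless these nodes
    contribute only [O(r)]. The remaining trees are, up to a factor [1 + 35 / r],
    bounded by the norms of at most [2 n] successive pieces of [x]. *)
Lemma forest_estimate s i0 (x : c00 R) :
  all (admissible L) s -> succ_forest s ->
  (forall i, i \in forest_leaves s -> (i0 <= i)%N) ->
  eval_forest s (absf x) <= C i0 * growth (size s) * N x.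
Proof.
have [m] := ubnP (forest_size s); elim: m s i0 x => // m IH s i0 x sm adm ss li.
have C0 i : 0 < C i by have := C_ge1 i; lra.
have Nx0 := N_ge0 normN x.
have [s0|s0] := posnP (size s).
  have g0 : 0 <= growth (size s).
    by rewrite addr_ge0 ?f_ge0 // le_min; apply/andP; split; rewrite mulr_ge0 ?sqrtr_ge0 ?f_ge0.
  apply: (@le_trans _ _ 0); last by rewrite mulr_ge0 // mulr_ge0 // ltW.
  by rewrite (size0nil s0) /eval_forest big_nil.
have child t u : t \in s -> children t = u -> (0 < size u)%N ->
    [/\ (forest_size u < m)%N & all (admissible L) u].
  move=> ts tu u0; split.
    rewrite ltnS in sm; apply: leq_trans sm.
    by rewrite -tu children_size // tu.
  have /allP/(_ t ts) := adm.
  by case: t tu {ts} => [|j|v|j v] /= tu; rewrite -?tu // => /andP[].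
(* The induction hypothesis for the children costs [growth], while the weight of the node gives back
   only [f]. *)
have node u (y : c00 R) : Node u \in s ->
    teval (Node u) (absf y) <= C i0 * (growth (size u) / f (size u)) * N y.
  move=> us; have /andP[u1 _] : admissible L (Node u) := allP adm _ us.
  have [um au] := child _ u us erefl (ltnW u1).
  have liu i : i \in forest_leaves u -> (i0 <= i)%N.
    by move=> iu; apply: li; apply/mem_forest_leaves; exists (Node u).
  have h := IH u i0 y um au (succ_forest_tree ss us) liu.
  have fu : 0 < f (size u) by apply: f_gt0; exact: ltnW.
  rewrite eval_node ler_pdivrMl //; apply: le_trans h _.
  by rewrite le_eqVlt; apply/orP; left; apply/eqP; field; rewrite gt_eqF.
(* Here the induction hypothesis is applied from the index [i.+1] on, and [C_growth] absorbs the
   quotient of [growth] and [f]; what remains besides the coordinate is [C i0] times a norm. *)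
have bad i u (y : c00 R) : Bad i u \in s ->
    teval (Bad i u) (absf y) <=
      `|y i| + C i0 * N (restr [set j | j \in forest_leaves u] y).
  move=> us; have /andP[u1 _] : admissible L (Bad i u) := allP adm _ us.
  have [um au] := child _ u us erefl (leq_ltn_trans (leq0n _) u1).
  have [su iu] := succ_bad (succ_forest_tree ss us).
  have fu : 0 < f (size u) by apply: f_gt0; exact: leq_ltn_trans (leq0n _) u1.
  rewrite eval_bad eval_forest_restr lerD2l ler_pdivrMl //.
  apply: le_trans (IH u i.+1 _ um au su iu) _.
  rewrite mulrA [_ * C i0]mulrC ler_wpM2r ?N_ge0 //.
  apply: le_trans (C_growth u1) _; rewrite ler_wpM2r ?(ltW fu) // C_dec // li //.
  by apply/mem_forest_leaves; exists (Bad i u); rewrite // mem_head.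
pose r := Num.sqrt (f (size s)).
have f1s : 1 <= f (size s) by exact: f_ge1.
have r2 : r ^+ 2 = f (size s) by rewrite sqr_sqrtr ?f_ge0.
have r1 : 1 <= r by rewrite /r -[leLHS]sqrtr1 ler_wsqrtr.
(* For short forests [growth] is [3 * f], and it suffices to bound each tree by [3 * C i0] times the
   norm of its own piece of [x]. *)
have [small|big] := leP (2 * f (size s)) (140 * r).
  rewrite /growth min_l // (_ : _ + _ = 3 * f (size s)); last by ring.
  have -> : C i0 * (3 * f (size s)) * N x = C i0 * 3 * (f (size s) * N x) by ring.
  have hp := @N_pieces _ N normN eqnN (map leaves s) x.
  rewrite size_map in hp; have {}hp := hp s0 ss.
  apply: (@le_trans _ _ (C i0 * 3 * \sum_(l <- map leaves s) N (restr [set i | i \in l] x))); last first.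
    by rewrite ler_wpM2l ?mulr_ge0 ?(ltW (C0 _)).
  rewrite big_map mulr_sumr /eval_forest big_seq [leRHS]big_seq; apply: ler_sum => t ts.
  rewrite restr_leaves_eval; set y := restr _ _; have y0 := N_ge0 normN y.
  have C1 := C_ge1 i0.
  case: t ts @y y0 => [|i|u|i u] ts y y0.
  - by rewrite /= !mulr_ge0 // ltW.
  - apply: (@le_trans _ _ (N y)); first exact: N_coord.
    by rewrite ler_peMl //; lra.
  - apply: le_trans (node _ _ ts) _; rewrite ler_wpM2r // ler_wpM2l ?(ltW (C0 _)) //.
    have /andP[u1 _] : admissible L (Node u) := allP adm _ ts.
    by rewrite ler_pdivrMr ?growth_le3 // f_gt0 //; exact: ltnW.
  - apply: le_trans (bad _ _ _ ts) _.
    have h1 := N_coord eqnN y i.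
    have h2 := N_restr normN eqnN [set j | j \in forest_leaves u] y.
    have : C i0 * N (restr [set j | j \in forest_leaves u] y) <= C i0 * N y.
      by rewrite ler_wpM2l // (ltW (C0 _)).
    have : N y <= C i0 * N y by rewrite ler_peMl.
    lra.
have r70 : 70 < r.
  have : 140 * r < 2 * (r * r) by rewrite -expr2 r2.
  by rewrite (_ : 140 * r = 2 * (70 * r)); [rewrite ltr_pM2l // ltr_pM2r //; lra | ring].
rewrite /growth min_r ?(ltW big) // -/r -r2.
have [K hK K0] : exists2 K, K = C i0 * N x & 0 <= K.
  by exists (C i0 * N x); rewrite // mulr_ge0 // ltW.
rewrite (_ : _ * _ * _ = K * (r ^+ 2 + 140 * r)); last by rewrite hK; ring.
set T := eval_forest s (absf x).
have [//|Tbig] := leP T (K * (r ^+ 2 + 140 * r)).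
pose low t := is_node t && (f (size (children t)) <= r).
pose mid t := is_node t && (r < f (size (children t)) <= 16 * r ^+ 2).
have T0 t : 0 <= teval t (absf x) by apply: eval_ge0 => i; exact: absf_ge0.
(* The opened forest has smaller [forest_size], so the induction hypothesis bounds its value. By
   [Tbig] this leaves little room for the gain of the opened nodes. *)
have nonempty P (p : pred tree) : (forall t, p t -> is_node t) -> 0 <= P ->
    (forall t, p t -> f (size (children t)) <= P) -> has p s ->
    \sum_(t <- s) (if p t then f (size (children t)) else 1) * teval t (absf x) <=
    K * ((r ^+ 2 + P) * (1 + 140 / r)).
  move=> pn P0 hP hp; rewrite -expand_eval //.
  have hs := expand_size_le s pn; rewrite hp addn1 in hs.
  apply: le_trans (IH (expand p s) i0 x _ _ _ _) _.
  - by rewrite ltnS in sm; exact: leq_trans hs sm.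
  - exact: expand_admissible.
  - by rewrite /succ_forest expand_leaves.
  - by rewrite expand_leaves.
  rewrite mulrAC -hK ler_wpM2l // growth_le //; first by lra.
  by rewrite r2; exact: expand_f.
pose V (p : pred tree) := \sum_(t <- s | p t) teval t (absf x).
have V0 p : 0 <= V p by apply: sumr_ge0.
(* A [low] node gains at least half of its value because [f >= 3 / 2], and the room left by [Tbig]
   is [K * (r + 140)], at most [3 * r * K] since [r > 70]. *)
have hVl : V low <= 6 * r * K.
  have [hl|hl] := boolP (has low s); last first.
    rewrite /V big1_seq => [|t /andP[lt ts]]; first by apply: mulr_ge0 => //; lra.
    by move/hasPn: hl => /(_ t ts); rewrite lt.
  have ln t : low t -> is_node t by move=> /andP[].
  have := nonempty r low ln _ _ hl => h.
  have {}h : T + (1 / 2) * V low <= K * ((r ^+ 2 + r) * (1 + 140 / r)).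
    apply: le_trans (h _ _); [|lra|by move=> t /andP[]].
    rewrite /T /V /eval_forest mulr_sumr [X in _ + X]big_mkcond -big_split /=.
    rewrite big_seq [leRHS]big_seq; apply: ler_sum => t ts.
    case: ifP => lt; last by rewrite mul1r addr0.
    have : 3 / 2 <= f (size (children t)).
      apply: f_ge32; have := allP adm _ ts; case/andP: lt => + _.
      by case: (t) => //= u _ /andP[].
    by have := T0 t; nra.
  have e : (r ^+ 2 + r) * (1 + 140 / r) = r ^+ 2 + 141 * r + 140.
    by field; lra.
  rewrite e in h; nra.
have hKr : 0 <= K * r * (r - 70).
  by apply: mulr_ge0; [apply: mulr_ge0 => //|]; lra.
(* A [mid] node gains [r - 1] times its value. The opened forest may be much longer, but
   [16 * r ^+ 2] still yields a bound of order [K * r ^+ 2], so division by [r - 1] leaves order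
   [K * r]. *)
have hVm : V mid <= 49 * r * K.
  have [hl|hl] := boolP (has mid s); last first.
    rewrite /V big1_seq => [|t /andP[lt ts]]; first by apply: mulr_ge0 => //; lra.
    by move/hasPn: hl => /(_ t ts); rewrite lt.
  have ln t : mid t -> is_node t by move=> /andP[].
  have := nonempty (16 * r ^+ 2) mid ln _ _ hl => h.
  have {}h : T + (r - 1) * V mid <= K * ((r ^+ 2 + 16 * r ^+ 2) * (1 + 140 / r)).
    apply: le_trans (h _ _); [|nra|by move=> t /and3P[]].
    rewrite /T /V /eval_forest mulr_sumr [X in _ + X]big_mkcond -big_split /=.
    rewrite big_seq [leRHS]big_seq; apply: ler_sum => t ts.
    case: ifP => lt; last by rewrite mul1r addr0.
    have : r < f (size (children t)) by case/and3P: lt.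
    by have := T0 t; nra.
  have e : (r ^+ 2 + 16 * r ^+ 2) * (1 + 140 / r) = 17 * r ^+ 2 + 2380 * r.
    by field; lra.
  rewrite e in h.
  have h2 : (r - 1) * V mid <= K * (48 * r ^+ 2).
    have := hKr.
    by nra.
  have r10 : 0 < r - 1 by lra.
  rewrite -(ler_pM2l r10); apply: le_trans h2 _.
  have := hKr.
  by nra.
pose rest t := ~~ low t && ~~ mid t.
(* The coordinate of a [Bad] tree becomes a piece of its own, hence at most two pieces per tree. *)
pose pcs t := match t with Bad i u => [:: [:: i]; forest_leaves u] | _ => [:: leaves t] end.
have pcs_flat u : flatten (flatten (map pcs u)) = forest_leaves u.
  elim: u => // t u IHu; rewrite /= flatten_cat IHu /forest_leaves /=; congr (_ ++ _).
  by case: t => //= *; rewrite ?cats0.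
have pcs_size u : (size (flatten (map pcs u)) <= 2 * size u)%N.
  elim: u => // t u IHu; rewrite /= size_cat mulnS.
  by apply: leq_add => //; case: t.
have pcs_size0 : (0 < size (flatten (map pcs s)))%N.
  case: (s) s0 => // t u _ /=; rewrite size_cat.
  by case: t.
(* The remaining [Node] trees have [f > 16 * r ^+ 2], so their quotient of [growth] and [f] is at
   most [1 + 140 / (4 * r)]. *)
have hVr : V rest <= K * ((1 + 35 / r) * (r ^+ 2 + 1)).
  apply: (@le_trans _ _ (C i0 * (1 + 35 / r) *
      \sum_(l <- flatten (map pcs s)) N (restr [set i | i \in l] x))).
    rewrite big_flatten big_map /= mulr_sumr /V big_mkcond big_seq [leRHS]big_seq.
    apply: ler_sum => t ts.
    have pos : 0 <= 35 / r by rewrite divr_ge0 //; lra.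
    have C35 : 1 <= C i0 * (1 + 35 / r) by rewrite mulr_ege1 //; lra.
    have C35' : C i0 <= C i0 * (1 + 35 / r) by rewrite ler_peMr ?(ltW (C0 _)) //; lra.
    have [rt|_] := boolP (rest t); last first.
      by rewrite mulr_ge0 //; [lra | apply: sumr_ge0 => l _; exact: N_ge0].
    case: t ts rt => [|i|u|i u] ts rt; rewrite /pcs.
    - by rewrite mulr_ge0 //; [lra | apply: sumr_ge0 => l _; exact: N_ge0].
    - rewrite big_seq1 restr_leaves_eval; set y := restr _ _.
      apply: (@le_trans _ _ (N y)); first exact: N_coord.
      by rewrite ler_peMl // N_ge0.
    - rewrite big_seq1 restr_leaves_eval; set y := restr _ _.
      apply: le_trans (node _ _ ts) _; rewrite ler_wpM2r ?N_ge0 // ler_wpM2l ?(ltW (C0 _)) //.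
      have fu : 16 * r ^+ 2 < f (size u).
        move: rt; rewrite /rest /low /mid /= -!ltNge => /andP[h1].
        by rewrite h1 /= -ltNge.
      have fu0 : 0 < f (size u) by apply: le_lt_trans fu; nra.
      rewrite ler_pdivrMr // /growth [leRHS]mulrDl [1 * _]mul1r lerD2l.
      apply: (@le_trans _ _ (140 * Num.sqrt (f (size u)))).
        by rewrite ge_min lexx orbT.
      set v := Num.sqrt _.
      have v2 : v ^+ 2 = f (size u) by rewrite sqr_sqrtr ?ltW.
      have v4 : 4 * r <= v.
        rewrite -(ler_pXn2r (n := 2)) ?nnegrE ?sqrtr_ge0 //; last by lra.
        by rewrite v2 exprMn; apply: ltW; apply: le_lt_trans fu; rewrite -natrX; lra.
      rewrite -v2 mulrAC ler_pdivlMr; last by lra.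
      by nra.
    - rewrite big_cons big_seq1.
      apply: le_trans (bad _ _ _ ts) _.
      have n1 : `|x i| <= N (restr [set j | j \in [:: i]] x).
        have := N_coord eqnN (restr [set j | j \in [:: i]] x) i.
        by rewrite /= /restr_fun mem_set //= mem_head.
      have n2 := N_ge0 normN (restr [set j | j \in forest_leaves u] x).
      have n3 := N_ge0 normN (restr [set j | j \in [:: i]] x).
      rewrite mulrDr lerD // ?ler_wpM2r //.
      by apply: le_trans n1 _; rewrite ler_peMl.
  rewrite (_ : K * _ = C i0 * (1 + 35 / r) * ((r ^+ 2 + 1) * N x)); last by rewrite hK; ring.
  rewrite ler_wpM2l //.
    by rewrite mulr_ge0 ?(ltW (C0 _)) // addr_ge0 // divr_ge0 //; lra.
  apply: le_trans (N_pieces normN eqnN x pcs_size0 _) _.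
    by rewrite pcs_flat.
  (* Doubling the number of pieces raises [f] by at most 1. *)
  rewrite ler_wpM2r // r2; apply: f_mul; first by [].
  rewrite mul1r lnK ?posrE //.
  rewrite -[X in _ * X]/(2%:R : R) -natrM ler_nat.
  by apply: leq_ltn_trans (pcs_size s) _; rewrite mulnC ltn_pmul2r.
have TV : T = V low + V mid + V rest.
  rewrite /T /V /eval_forest [in X in _ = X + _ + _]big_mkcond.
  rewrite [in X in _ = _ + X + _]big_mkcond [in X in _ = _ + _ + X]big_mkcond.
  rewrite -!big_split /=; apply: eq_bigr => t _; rewrite /rest.
  case lt : (low t) => /=; last by case: (mid t); rewrite /= ?add0r ?addr0.
  rewrite (_ : mid t = false) ?addr0 //.
  apply/negP => /and3P[_ h' _]; case/andP: lt => _ h.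
  by have := lt_le_trans h' h; rewrite ltxx.
have e : (1 + 35 / r) * (r ^+ 2 + 1) = r ^+ 2 + 35 * r + 1 + 35 / r by field; lra.
rewrite e in hVr.
(* The three shares add up to at most [K * (r ^+ 2 + 90 * r + 2)], with 90 = 6 + 49 + 35. *)
have : 35 / r <= 1 by rewrite ler_pdivrMr; lra.
nra.
Qed.
End ForestEstimate.

(** * Reduction from averages to the basis *)

Section Assign.
Variable R : realType.

Definition unit_at (i : nat) : nat -> R := fun k => (k == i)%:R.

Lemma eval_units t (b : nat -> R) I : (forall i, i \in leaves t -> (i < I)%N) ->
  teval t b = \sum_(i < I) teval t (unit_at i) * b i.
Proof.
move=> tI; rewrite (eq_bigr (fun i : 'I_I => teval t (fun k => b i * unit_at i k))); last first.
  by move=> i _; rewrite eval_scale mulrC.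
rewrite -eval_sum; apply: eval_ext => k /tI kI.
rewrite (bigD1 (Ordinal kI)) //= /unit_at eqxx mulr1 big1 ?addr0 // => i ik.
by rewrite eq_sym -val_eqE /= in ik; rewrite (negbTE ik) mulr0.
Qed.

(** A coordinate shared by several trees is given to the tree in which it has the
    largest coefficient. *)
Lemma assign_leaves (l I : nat) (g : 'I_l -> tree) (rj : 'I_l -> nat -> R) (r : nat -> R) :
  (0 < l)%N ->
  (forall j, succ_tree (g j)) ->
  (forall j i, i \in leaves (g j) -> (i < I)%N) ->
  (forall (j k : 'I_l) a b, (j < k)%N -> a \in leaves (g j) -> b \in leaves (g k) -> (a <= b)%N) ->
  (forall j i, 0 <= rj j i) -> (forall i, \sum_j rj j i <= r i) ->
  exists F : 'I_l -> pred nat,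
    succ_forest [seq tree_restr (F j) (g j) | j <- enum 'I_l] /\
    \sum_j teval (g j) (rj j) <= eval_forest [seq tree_restr (F j) (g j) | j <- enum 'I_l] r.
Proof.
move=> l0 sg gI gle rj0 rjr.
pose cf i j := teval (g j) (unit_at i).
pose jmax i := [arg max_(j > Ordinal l0) cf i j]%O.
have cfmax i j : cf i j <= cf i (jmax i).
  by rewrite /jmax; case: arg_maxP => //= m _; apply.
have cf0 i j : 0 <= cf i j by apply: eval_ge0 => k; rewrite /unit_at ler0n.
pose F j : pred nat := fun i => jmax i == j.
exists F; split.
  apply/succ_forestP; rewrite size_map size_enum_ord; split=> [j jl|j k /andP[jk kl]].
    by rewrite (nth_map (Ordinal jl)) ?size_enum_ord //; exact: succ_restr.
  have jl := ltn_trans jk kl => a b.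
  rewrite (nth_map (Ordinal jl)) ?size_enum_ord // (nth_map (Ordinal kl)) ?size_enum_ord //.
  rewrite !leaves_restr !mem_filter => /andP[Fa ha] /andP[Fb hb].
  set j' := nth (Ordinal jl) (enum 'I_l) j in Fa ha.
  set k' := nth (Ordinal kl) (enum 'I_l) k in Fb hb.
  have jk' : (j' < k')%N by rewrite /j' /k' !nth_enum_ord.
  (* Two trees may share an index, but after the assignment it survives in one of them only, so
     equality is excluded. *)
  have := gle _ _ _ _ jk' ha hb; rewrite leq_eqVlt => /predU1P[ab|//].
  by move: Fb Fa; rewrite /F ab => /eqP -> /eqP e; rewrite e ltnn in jk'.
rewrite /eval_forest big_map big_enum /=.
rewrite (eq_bigr (fun j => \sum_(i < I) cf i j * rj j i)); last first.
  by move=> j _; rewrite (eval_units _ (gI j)).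
rewrite [leRHS](eq_bigr (fun j => \sum_(i < I) (if jmax i == j then cf i j * r i else 0))); last first.
  move=> j _; rewrite eval_restr (eval_units _ (gI j)); apply: eq_bigr => i _.
  by rewrite /F; case: ifP; rewrite ?mulr0.
rewrite exchange_big [leRHS]exchange_big /=; apply: ler_sum => i _.
rewrite -[leRHS]big_mkcond /= [leRHS](big_pred1 (jmax i)); last by move=> j /=; rewrite eq_sym.
apply: (@le_trans _ _ (cf i (jmax i) * \sum_j rj j i)); last by rewrite ler_wpM2l.
by rewrite mulr_sumr; apply: ler_sum => j _; rewrite ler_wpM2r.
Qed.
End Assign.

(** * Error of sharing an average among the children of a node *)

Section SplitError.
Variable R : realType.

Fixpoint split_const (l k : nat) : nat :=
  if k is k'.+1 then l * (split_const l k').+1 else 0.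

(** Error made on [p] atoms of a block when splittings of arity at most [l] are
    followed through [k] generations: for [p] large it is [o(p)], as [k] grows. *)
Definition split_error (l k p : nat) : R :=
  if p == 0%N then 0 else (split_const l k)%:R + 3 * (2 / 3) ^+ k * p%:R.

Lemma split_error_ge0 l k p : 0 <= split_error l k p.
Proof.
by rewrite /split_error; case: eqP.
Qed.

Lemma split_error_ge1 l k p : (0 < l)%N -> (0 < p)%N -> 1 <= split_error l k p.
Proof.
move=> l0 p0; rewrite /split_error gtn_eqF //; case: k => [|k] /=.
  rewrite expr0 add0r mulr1; have : (1 <= p%:R :> R) by rewrite ler1n.
  lra.
have h1 : 1 <= (l * (split_const l k).+1)%:R :> R by rewrite ler1n muln_gt0 l0.
have h2 : 0 <= 3 * (2 / 3) ^+ k.+1 * p%:R :> R by [].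
lra.
Qed.

(** The weight [F^-1 <= 2 / 3] turns the linear terms of the children into that of the parent, and
    the constants of the children together with the cut atoms fit into the next [split_const]. Once
    [k] is 0, the linear coefficient 3 is stable by itself: [2 / 3 * 3 = 2] for the children and 1
    for each cut atom. *)
Lemma split_error_step (l0 l k p cut : nat) (pj : 'I_l -> nat) (F : R) :
  (1 < l)%N -> (l <= l0)%N -> 3 / 2 <= F ->
  (\sum_j pj j + cut <= p)%N -> (cut <= l)%N ->
  F^-1 * (\sum_j split_error l0 k.-1 (pj j)) + cut%:R <= split_error l0 k p.
Proof.
move=> l1 ll F32 pc cl.
have F0 : 0 < F by lra.
have Fi : F^-1 <= 2 / 3 by rewrite -[2 / 3]invrK lef_pV2 ?posrE ?invr_gt0; lra.
have Fi0 : 0 <= F^-1 by rewrite invr_ge0 ltW.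
have pcR : \sum_j (pj j)%:R + cut%:R <= p%:R :> R by rewrite -natr_sum -natrD ler_nat.
have cut0 : (0 <= cut%:R :> R) by [].
have pj0 : 0 <= \sum_j (pj j)%:R :> R by apply: sumr_ge0.
case: (posnP p) => [p0|p0].
  have c0 : cut = 0%N by lia.
  have pj00 j : pj j = 0%N.
    have : (\sum_j pj j == 0)%N by lia.
    by rewrite sum_nat_eq0 => /forallP/(_ j)/eqP.
  by rewrite big1 ?c0 ?p0 ?mulr0 ?addr0 // => j _; rewrite pj00 /split_error eqxx.
rewrite [leRHS]/split_error (gtn_eqF p0).
case: k => [|k] /=.
  have h : \sum_j split_error l0 0 (pj j) <= 3 * \sum_j (pj j)%:R.
    rewrite mulr_sumr; apply: ler_sum => j _; rewrite /split_error; case: eqP => [->|_].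
      by rewrite mulr0.
    by rewrite /= expr0 add0r mulr1.
  rewrite expr0 add0r mulr1.
  have := ler_wpM2l Fi0 h.
  have : F^-1 * (3 * \sum_j (pj j)%:R) <= 2 / 3 * (3 * \sum_j (pj j)%:R).
    by rewrite ler_wpM2r // mulr_ge0.
  lra.
have th0 : 0 <= (2 / 3) ^+ k :> R by rewrite exprn_ge0.
have h : \sum_j split_error l0 k (pj j) <=
    (l * split_const l0 k)%:R + 3 * (2 / 3) ^+ k * \sum_j (pj j)%:R.
  have -> : (l * split_const l0 k)%:R = \sum_(j < l) (split_const l0 k)%:R :> R.
    by rewrite sumr_const card_ord natrM mulr_natl.
  rewrite mulr_sumr -big_split /=; apply: ler_sum => j _; rewrite /split_error.
  by case: eqP => [->|_]; rewrite ?mulr0 ?addr0 ?ler0n ?lexx.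
have h1 := ler_wpM2l Fi0 h.
have h2 : F^-1 * (l * split_const l0 k)%:R <= (l * split_const l0 k)%:R.
  by rewrite ler_piMl // ?ler0n //; lra.
have h3 : F^-1 * (3 * (2 / 3) ^+ k * \sum_j (pj j)%:R) <=
    2 / 3 * (3 * (2 / 3) ^+ k * p%:R).
  apply: ler_pM => //; first by rewrite !mulr_ge0.
  by apply: ler_wpM2l; [rewrite mulr_ge0|lra].
have h4 : (l * split_const l0 k)%:R + cut%:R <= (l0 * (split_const l0 k).+1)%:R :> R.
  rewrite -natrD ler_nat mulnS addnC; apply: leq_add; first exact: leq_trans cl ll.
  by rewrite leq_mul2r ll orbT.
rewrite mulrDr in h1; rewrite exprS.
have -> : 3 * (2 / 3 * (2 / 3) ^+ k) * p%:R = 2 / 3 * (3 * (2 / 3) ^+ k * p%:R) :> R by ring.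
lra.
Qed.
End SplitError.

(** * From trees on atoms to trees on indices of averages *)

Section Blocks.
Variable R : realType.
Local Notation f := (@schlumprecht_f R).
(** [u q] stands for the absolute value of the atom [q] and [kap q] for the average it belongs to.
    The average [i] has at most [n i] atoms, each of l1 norm at most [w i] and each occurring with
    the coefficient [c i]. *)
Variables (L : nat -> nat) (Q I : nat) (kap : 'I_Q -> nat) (u : 'I_Q -> nat -> R).
Variables (w : nat -> R) (n : nat -> nat) (c : nat -> R).
Hypothesis L0 : forall i, (0 < L i)%N.
Hypothesis Lmono : forall i j, (i <= j)%N -> (L i <= L j)%N.
Hypothesis kapI : forall q, (kap q < I)%N.
Hypothesis kap_mono : forall p q : 'I_Q, (p <= q)%N -> (kap p <= kap q)%N.
Hypothesis u0 : forall q m, 0 <= u q m.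
Hypothesis u_succ : forall (p q : 'I_Q) m m', (p < q)%N ->
  u p m != 0 -> u q m' != 0 -> (m < m')%N.
Hypothesis u_le1 : forall q t, pure t -> succ_tree t -> teval t (u q) <= 1.
Hypothesis u_l1 : forall q (l : seq nat), uniq l -> \sum_(m <- l) u q m <= w (kap q).
Hypothesis n_kap : forall i, (#|[pred q | kap q == i]| <= n i)%N.
Hypothesis tiny : forall i j l, (i < j)%N -> (L j < l)%N -> w i * (n i)%:R <= f l.
Hypothesis c0 : forall i, 0 <= c i.
Implicit Types (B : {set 'I_Q}).

Definition cnt B i := #|[set q in B | kap q == i]|.

Lemma sum_kap B (F : 'I_Q -> R) :
  \sum_(q in B) c (kap q) * F q =
  \sum_(i < I) c i * \sum_(q in B | kap q == i) F q.
Proof.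
rewrite (partition_big (fun q => Ordinal (kapI q)) xpredT) //=.
apply: eq_bigr => i _; rewrite mulr_sumr; apply: eq_big => [q|q /andP[_ /eqP <-] //].
by rewrite -val_eqE.
Qed.

Lemma cnt_sum B i : (cnt B i)%:R = \sum_(q in B | kap q == i) 1 :> R.
Proof. by rewrite /cnt cardsE sumr_const. Qed.

Lemma eval_neq0 t (b : nat -> R) : teval t b != 0 -> exists2 m, m \in leaves t & b m != 0.
Proof.
move=> h; apply: contrapT => hn; move/eqP: h; apply.
rewrite -(eval0 R t); apply: eval_ext => i it; apply: contrapT => /eqP bi.
by apply: hn; exists i.
Qed.

Lemma eval_block t q : teval t (u q) != 0 -> exists2 m, m \in leaves t & u q m != 0.
Proof. exact: eval_neq0. Qed.

(** At a node of arity [l] the indices with [l <= L i] are passed on to the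
    children, except for at most [l] cut atoms; the largest index with [L i < l]
    becomes the additional coordinate, and the smaller ones are negligible. *)
Lemma reduce_tree phi B (k : nat -> nat) : pure phi -> succ_tree phi ->
  exists t, [/\ admissible L t, succ_tree t,
    forall i, i \in leaves t -> exists2 q, q \in B & kap q = i &
    \sum_(q in B) c (kap q) * teval phi (u q) <=
      teval t (fun i => c i * (cnt B i)%:R) +
      \sum_(i < I) c i * split_error R (L i) (k i) (cnt B i)].
Proof.
have err0 B' k' : 0 <= \sum_(i < I) c i * split_error R (L i) (k' i) (cnt B' i).
  by apply: sumr_ge0 => i _; rewrite mulr_ge0 ?split_error_ge0.
elim/tree_seq_ind: phi B k => [|m|s IH|i s IH] B k //.
- move=> _ _; exists Zero; split=> //=.
  by rewrite big1 ?add0r // => q _; rewrite mulr0.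
- move=> _ _.
  have [/existsP[q0 /andP[q0B q0m]]|none] := boolP [exists q, (q \in B) && (u q m != 0)].
    exists (Leaf (kap q0)); split=> //=.
      by move=> i; rewrite inE => /eqP ->; exists q0.
    rewrite (bigD1 q0) //= big1 ?addr0 => [|q /andP[qB qq0]]; last first.
      have [->|h] := eqVneq (u q m) 0; first by rewrite mulr0.
      move: qq0; rewrite -val_eqE /=; case: ltngtP => // qq0 _.
        by have := u_succ qq0 h q0m; rewrite ltnn.
      by have := u_succ qq0 q0m h; rewrite ltnn.
    rewrite -[leLHS]addr0 lerD // ler_wpM2l //.
    apply: (@le_trans _ _ 1); first exact: (u_le1 q0 (t := Leaf m)).
    by rewrite ler1n card_gt0; apply/set0Pn; exists q0; rewrite inE q0B eqxx.
  exists Zero; split=> //=; rewrite big1 ?add0r // => q qB.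
  have [->|h] := eqVneq (u q m) 0; first by rewrite mulr0.
  by case/existsP: none; exists q; rewrite qB.
move=> /andP[s1 /allP ps]; rewrite succ_node => ss.
set l := size s in s1 *.
have l0 : (0 < l)%N := ltnW s1.
have fl : 3 / 2 <= f l := f_ge32 R s1.
have fl0 : 0 < f l by lra.
have fli0 : 0 <= (f l)^-1 by rewrite invr_ge0 ltW.
pose e (j : 'I_l) q := teval (nth Zero s j) (u q).
have e0 j q : 0 <= e j q by apply: eval_ge0.
have memj (j : 'I_l) : nth Zero s j \in s := mem_nth Zero (ltn_ord j).
pose E q := teval (Node s) (u q).
have EE q : E q = (f l)^-1 * \sum_j e j q.
  by rewrite /E eval_node /eval_forest (big_nth Zero) big_mkord.
have E1 q : E q <= 1 by apply: u_le1 => //; apply/andP; split=> //; exact/allP.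
have /succ_forestP[_ leaf_lt] := ss.
have e_lt (j j' : 'I_l) p q : (j < j')%N -> e j p != 0 -> e j' q != 0 -> (p <= q)%N.
  move=> jj /eval_block[m mj um] /eval_block[m' mj' um'].
  rewrite leqNgt; apply/negP => qp.
  have := u_succ qp um' um; apply/negP; rewrite -leqNgt ltnW //.
  by apply: (leaf_lt j j') => //; rewrite jj /=.
pose G q := (l <= L (kap q))%N.
pose cut q := [exists j, exists j', [&& j != j', e j q != 0 & e j' q != 0]].
pose Bj (j : 'I_l) : {set 'I_Q} := [set q in B | [&& G q, ~~ cut q & e j q != 0]].
pose cutB := [set q in B | G q && cut q].
(* Send a cut atom to a child that meets it and is followed by another child meeting it. Two atoms
   with the same image would each precede the other, so this map is injective. *)
have cut_le i : (cnt cutB i <= l)%N.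
  rewrite -[leqRHS]card_ord.
  pose J q := odflt (Ordinal l0)
    [pick j | (e j q != 0) && [exists j' : 'I_l, (j < j')%N && (e j' q != 0)]].
  have cutJ q : cut q -> e (J q) q != 0 /\ exists2 j' : 'I_l, (J q < j')%N & e j' q != 0.
    move=> /existsP[a /existsP[b /and3P[ab ea eb]]].
    rewrite /J; case: pickP => [j /andP[ej /existsP[j' /andP[jj' ej']]]|none] /=.
      by split=> //; exists j'.
    case: (ltngtP a b) => [lt|lt|/val_inj eab]; last by rewrite eab eqxx in ab.
      by have := none a; rewrite ea /= => /existsP[]; exists b; rewrite lt.
    by have := none b; rewrite eb /= => /existsP[]; exists a; rewrite lt.
  rewrite /cnt; set X := [set q in cutB | _].
  suff injJ : {in X &, injective J} by rewrite -(card_in_imset injJ) max_card.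
  move=> p q; rewrite !inE.
  move=> /andP[/and3P[_ _ cp] _] /andP[/and3P[_ _ cq] _] Jpq.
  have [ep [p' jp ep']] := cutJ p cp; have [eq [q' jq eq']] := cutJ q cq.
  apply/val_inj/anti_leq/andP; split.
    by rewrite -Jpq in jq; exact: e_lt jq ep eq'.
  by rewrite Jpq in jp; exact: e_lt jp eq ep'.
have disj (j j' : 'I_l) q : q \in Bj j -> q \in Bj j' -> j = j'.
  rewrite !inE => /and4P[_ _ nc ej] /and4P[_ _ _ ej']; apply/eqP/negP => /negP jj.
  by move/negP: nc; apply; apply/existsP; exists j; apply/existsP; exists j'; rewrite jj ej.
have cnt_split i : (\sum_j cnt (Bj j) i + cnt cutB i <= cnt B i)%N.
  have cntE X : cnt X i = (\sum_q ((q \in X) && (kap q == i)))%N.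
    by rewrite /cnt -sum1_card big_mkcond; apply: eq_bigr => q _; rewrite inE; case: (_ && _).
  rewrite !cntE (eq_bigr _ (fun j _ => cntE (Bj j))) exchange_big -big_split /=.
  apply: leq_sum => q _; case: (kap q == i); last first.
    by rewrite !andbF big1 // => j _; rewrite andbF.
  rewrite !andbT; under eq_bigr do rewrite andbT.
  have [/existsP[j qj]|none] := boolP [exists j, q \in Bj j].
    rewrite (bigD1 j) //= big1 ?addn0 => [|j' jj']; last first.
      by case: (boolP (q \in Bj j')) => // /(disj _ _ _ qj) e'; rewrite e' eqxx in jj'.
    move: qj; rewrite !inE => /and4P[-> -> /negbTE -> ->].
    by [].
  rewrite big1 => [|j _]; first by rewrite inE add0n; case: (q \in B) => //=; exact: leq_b1.
  by case: (boolP (q \in Bj j)) => // qj; case/existsP: none; exists j.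
have cntj0 (j : 'I_l) i : (L i < l)%N -> cnt (Bj j) i = 0%N.
  move=> Li; apply/eqP; rewrite cards_eq0; apply/eqP/setP => q; rewrite !inE.
  by apply/negP => /andP[/and4P[_ + _ _] /eqP qi]; rewrite /G qi leqNgt Li.
have cntc0 i : (L i < l)%N -> cnt cutB i = 0%N.
  move=> Li; apply/eqP; rewrite cards_eq0; apply/eqP/setP => q; rewrite !inE.
  by apply/negP => /andP[/and3P[_ + _] /eqP qi]; rewrite /G qi leqNgt Li.
have ht j : exists t, [/\ admissible L t, succ_tree t,
    forall i, i \in leaves t -> exists2 q, q \in Bj j & kap q = i &
    \sum_(q in Bj j) c (kap q) * e j q <=
      teval t (fun i => c i * (cnt (Bj j) i)%:R) +
      \sum_(i < I) c i * split_error R (L i) (k i).-1 (cnt (Bj j) i)].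
  apply: (IH _ (memj j) (Bj j) (fun i => (k i).-1)); first exact: ps.
  exact: succ_forest_tree ss (memj j).
have {}[g hg] := choice ht.
have [F [sF leF]] : exists F : 'I_l -> pred nat,
    succ_forest [seq tree_restr (F j) (g j) | j <- enum 'I_l] /\
    \sum_j teval (g j) (fun i => c i * (cnt (Bj j) i)%:R) <=
    eval_forest [seq tree_restr (F j) (g j) | j <- enum 'I_l] (fun i => c i * (cnt B i)%:R).
  apply: (@assign_leaves R l I) => //.
  - by move=> j; case: (hg j).
  - by move=> j i; case: (hg j) => _ _ h _ /h[q _ <-].
  - move=> j j' a b jj; case: (hg j) => _ _ h _ /h[p pB <-].
    case: (hg j') => _ _ h' _ /h'[q qB <-]; apply: kap_mono.
    move: pB qB; rewrite !inE => /and4P[_ _ _ ep] /and4P[_ _ _ eq].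
    exact: e_lt jj ep eq.
  - by move=> j i; rewrite mulr_ge0 ?ler0n.
  - move=> i; rewrite -mulr_sumr ler_wpM2l // -natr_sum ler_nat.
    by apply: leq_trans (cnt_split i); exact: leq_addr.
set S' := [seq tree_restr (F j) (g j) | j <- enum 'I_l] in sF leF.
have sizeS : size S' = l by rewrite size_map size_enum_ord.
have admS : all (admissible L) S'.
  by apply/allP => _ /mapP[j _ ->]; apply: admissible_restr => //; case: (hg j).
have leavesS i : i \in forest_leaves S' -> exists j, exists2 q, q \in Bj j & kap q = i.
  move=> /mem_forest_leaves[_ /mapP[j _ ->]]; rewrite leaves_restr mem_filter => /andP[_].
  by case: (hg j) => _ _ h _ /h h'; exists j.
have good_part : \sum_(q in B | G q) c (kap q) * E q <=
    (f l)^-1 * eval_forest S' (fun i => c i * (cnt B i)%:R) +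
    \sum_(i < I | (l <= L i)%N) c i * split_error R (L i) (k i) (cnt B i).
  have h1 : \sum_(q in B | G q) c (kap q) * E q =
      \sum_(q in cutB) c (kap q) * E q + \sum_j (f l)^-1 * \sum_(q in Bj j) c (kap q) * e j q.
    rewrite (bigID cut) /=; congr (_ + _).
      by apply: eq_bigl => q; rewrite inE andbA.
    rewrite -mulr_sumr (exchange_big_dep (fun q => (q \in B) && G q && ~~ cut q)) /=; last first.
      by move=> j q _; rewrite inE => /and4P[-> -> ->].
    rewrite mulr_sumr; apply: eq_bigr => q /andP[/andP[qB Gq] nc].
    rewrite EE mulrCA -mulr_sumr; congr (_ * (_ * _)); rewrite [RHS]big_mkcond /=.
    apply: eq_bigr => j _; rewrite inE qB Gq nc /=.
    by case: eqP.
  have h2 : \sum_(q in cutB) c (kap q) * E q <= \sum_(i < I) c i * (cnt cutB i)%:R.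
    rewrite sum_kap; apply: ler_sum => i _; rewrite ler_wpM2l // cnt_sum.
    exact: ler_sum.
  rewrite h1 -mulr_sumr.
  have h3 : \sum_j \sum_(q in Bj j) c (kap q) * e j q <=
      eval_forest S' (fun i => c i * (cnt B i)%:R) +
      \sum_(i < I) c i * \sum_j split_error R (L i) (k i).-1 (cnt (Bj j) i).
    under [X in _ + X]eq_bigr do rewrite mulr_sumr.
    rewrite exchange_big /=; apply: le_trans (_ : _ <= _) (lerD leF (lexx _)).
    by rewrite -big_split /=; apply: ler_sum => j _; case: (hg j).
  apply: (@le_trans _ _ (\sum_(i < I) c i * (cnt cutB i)%:R + (f l)^-1 *
     (eval_forest S' (fun i => c i * (cnt B i)%:R) +
      \sum_(i < I) c i * \sum_j split_error R (L i) (k i).-1 (cnt (Bj j) i)))).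
    by apply: lerD => //; rewrite ler_wpM2l.
  rewrite mulrDr addrCA lerD2l mulr_sumr -big_split /= [leRHS]big_mkcond /=.
  apply: ler_sum => i _; rewrite mulrCA -mulrDr; case: ifPn => [lL|].
    rewrite ler_wpM2l // addrC; exact: split_error_step.
  rewrite -ltnNge => Li; rewrite cntc0 // big1 ?mulr0 ?addr0 ?mulr0 // => j _.
  by rewrite cntj0 // /split_error eqxx.
have bad_part i : \sum_(q in B | kap q == i) E q <= (cnt B i)%:R.
  by rewrite cnt_sum; apply: ler_sum.
(* The whole mass of the average [i] is at most [w i * n i]; by [tiny] the weight of the node brings
   it down to 1, which a nonzero [split_error] covers. *)
have tiny_part i j : (L i < l)%N -> (i < j)%N -> (L j < l)%N ->
    \sum_(q in B | kap q == i) E q <= split_error R (L i) (k i) (cnt B i).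
  move=> Li ij Lj; have [p0|p0] := posnP (cnt B i).
    by apply: le_trans (bad_part i) _; rewrite p0 split_error_ge0.
  apply: le_trans (split_error_ge1 R (k i) (L0 i) p0).
  apply: (@le_trans _ _ ((cnt B i)%:R * (w i / f l))).
    rewrite cnt_sum mulr_suml; apply: ler_sum => q /andP[_ /eqP qi].
    rewrite mul1r EE mulrC ler_wpM2r // -qi.
    apply: le_trans (_ : \sum_(m <- forest_leaves s) u q m <= _); last first.
      by apply: u_l1; apply: (sorted_uniq ltn_trans ltnn).
    rewrite /forest_leaves big_flatten big_map (big_nth Zero) big_mkord.
    by apply: ler_sum => jj _; exact: eval_le_leaves.
  rewrite mulrA ler_pdivrMr // mul1r; apply: le_trans (tiny ij Lj); rewrite mulrC.
  apply: ler_wpM2l; last first.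
    rewrite ler_nat; apply: leq_trans (n_kap i); apply: subset_leq_card.
    by apply/fintype.subsetP => q; rewrite !inE => /andP[].
  case/card_gt0P: p0 => q; rewrite inE => /andP[_ /eqP <-].
  by have := u_l1 q (l := [::]) isT; rewrite big_nil.
have splitE : \sum_(q in B) c (kap q) * E q =
    \sum_(q in B | G q) c (kap q) * E q +
    \sum_(i < I | (L i < l)%N) c i * \sum_(q in B | kap q == i) E q.
  rewrite (bigID G) /=; congr (_ + _).
  rewrite (eq_bigl (fun q => q \in [set q in B | ~~ G q])); last by move=> q; rewrite inE.
  rewrite sum_kap [RHS]big_mkcond; apply: eq_bigr => i _; case: ifPn => Li.
    congr (_ * _); apply: eq_bigl => q; rewrite inE /G.
    by case: eqP => [->|]; rewrite ?andbF // -ltnNge Li !andbT.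
  rewrite big1 ?mulr0 // => q; rewrite inE /G => /andP[/andP[_ h] /eqP qi].
  by rewrite -ltnNge qi (negbTE Li) in h.
have err_split : \sum_(i < I) c i * split_error R (L i) (k i) (cnt B i) =
    \sum_(i < I | (l <= L i)%N) c i * split_error R (L i) (k i) (cnt B i) +
    \sum_(i < I | (L i < l)%N) c i * split_error R (L i) (k i) (cnt B i).
  rewrite (bigID (fun i : 'I_I => (l <= L i)%N)) /=; congr (_ + _).
  by apply: eq_bigl => i; rewrite -ltnNge.
have leavesB i : i \in forest_leaves S' -> exists2 q, q \in B & kap q = i.
  by move=> /leavesS[j [q qj <-]]; exists q => //; move: qj; rewrite inE => /andP[].
pose P q := (q \in B) && (L (kap q) < l)%N.
(* [P] selects the atoms with bad index. The largest bad index lies to the left of all leaves of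
   [S'], because these have [l <= L i] and [L] is monotone. *)
have [/existsP[q0 q0B]|none] := boolP [exists q, P q].
  pose qm := [arg max_(q > q0 | P q) kap q]%N.
  have [qmB qm_max] : P qm /\ (forall q, P q -> (kap q <= kap qm)%N).
    by rewrite /qm; case: arg_maxnP.
  have /andP[qmB' Lqm] := qmB.
  exists (Bad (kap qm) S'); split.
  - by rewrite /= sizeS Lqm admS.
  - rewrite /succ_tree /= (path_sortedE ltn_trans) -/(forest_leaves S'); apply/andP; split=> //.
    apply/allP => i /leavesS[j [q qj <-]]; rewrite ltnNge; apply/negP => /Lmono Lq.
    by move: qj; rewrite inE /G => /and4P[_ lL _ _]; rewrite ltnNge (leq_trans lL Lq) in Lqm.
  - move=> i; rewrite /= inE => /predU1P[->|/leavesB //]; by exists qm.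
  rewrite -/(E _) splitE eval_bad sizeS err_split.
  have h : \sum_(i < I | (L i < l)%N) c i * (\sum_(q in B | kap q == i) E q) <=
      c (kap qm) * (cnt B (kap qm))%:R +
      \sum_(i < I | (L i < l)%N) c i * split_error R (L i) (k i) (cnt B i).
    rewrite (bigD1 (Ordinal (kapI qm))) //=; apply: lerD; first by rewrite ler_wpM2l.
    rewrite [leRHS](bigD1 (Ordinal (kapI qm))) //= -[leLHS]add0r; apply: lerD.
      by rewrite mulr_ge0 ?split_error_ge0.
    apply: ler_sum => i /andP[Li iq]; rewrite ler_wpM2l //.
    case: (ltngtP i (kap qm)) => [lt|gt|eq].
    - exact: tiny_part lt Lqm.
    - rewrite big1 ?split_error_ge0 // => q /andP[qB /eqP qi].
      by have := qm_max q; rewrite /P qB qi Li => /(_ isT); rewrite leqNgt gt.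
    - by rewrite -val_eqE /= eq eqxx in iq.
  have := lerD good_part h.
  lra.
exists (Node S'); split.
- by rewrite /= sizeS s1 admS.
- by [].
- exact: leavesB.
have h : \sum_(i < I | (L i < l)%N) c i * (\sum_(q in B | kap q == i) E q) <=
    \sum_(i < I | (L i < l)%N) c i * split_error R (L i) (k i) (cnt B i).
  apply: ler_sum => i Li; rewrite ler_wpM2l // big1 ?split_error_ge0 // => q /andP[qB /eqP qi].
  by case/existsP: none; exists q; rewrite /P qB qi Li.
rewrite -/(E _) splitE eval_node sizeS err_split.
have := lerD good_part h.
lra.
Qed.
End Blocks.

(** * Thresholds for arities and lengths of averages *)

Section Thresholds.
Variable R : realType.
Local Notation f := (@schlumprecht_f R).

(** These are the constants [C i] of the forest estimate, with drop [2 ^- i.+1] from [i] to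
    [i.+1]. *)
Definition decay (i : nat) : R := 1 + 2 ^- i.

Lemma decay_ge1 i : 1 <= decay i.
Proof. by rewrite lerDl invr_ge0 exprn_ge0. Qed.

Lemma decay_dec i j : (i <= j)%N -> decay j <= decay i.
Proof.
move=> ij; rewrite lerD2l lef_pV2 ?posrE ?exprn_gt0 //.
by rewrite ler_eXn2l // ltr1n.
Qed.

Lemma f_large (A : R) : exists L, forall l, (L < l)%N -> A <= f l.
Proof.
exists (Num.truncn (expR (A * ln 2))) => l Ll.
rewrite /schlumprecht_f ler_pdivlMr ?ln2_gt0 // -[leLHS]expRK ln_mono ?expR_gt0 //.
apply: ltW; apply: lt_le_trans (truncnS_gt _) _.
by rewrite ler_nat ltnW.
Qed.

(** The drop of [decay] times [f l] has to beat [decay i.+1 * 140] times the square root of [f l].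
    As [decay i.+1 <= 2], it suffices that this root is at least [280 * 2 ^+ i.+1]. *)
Lemma growth_large i : exists L, forall l, (L < l)%N ->
  decay i.+1 * growth R l <= decay i * f l.
Proof.
have [L hL] := f_large ((280 * 2 ^+ i.+1) ^+ 2).
exists L => l /hL h.
set s := Num.sqrt (f l).
have s2 : s ^+ 2 = f l by rewrite sqr_sqrtr ?f_ge0.
have p0 : 0 < 2 ^+ i.+1 :> R by rewrite exprn_gt0.
have sl : 280 * 2 ^+ i.+1 <= s.
  rewrite -(@ler_pXn2r _ 2) ?s2 //; last by rewrite nnegrE sqrtr_ge0.
  by rewrite nnegrE; apply: mulr_ge0; [exact: ler0n | exact: ltW].
have s0 : 0 <= s by apply: sqrtr_ge0.
have e : decay i = decay i.+1 + 2 ^- i.+1.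
  rewrite /decay exprS; field; rewrite expf_eq0 /=; lra.
have c2 : decay i.+1 <= 2.
  rewrite /decay; have : (2 ^+ i.+1)^-1 <= (1 : R).
    by rewrite invf_le1 // exprn_ege1 // ler1n.
  lra.
apply: (@le_trans _ _ (decay i.+1 * (f l + 140 * s))).
  rewrite ler_wpM2l //; first by have := decay_ge1 i.+1; lra.
  by rewrite /growth lerD2l ge_min lexx orbT.
rewrite e [leRHS]mulrDl [leLHS]mulrDr lerD2l -s2.
have h1 : 280 * s <= 2 ^- i.+1 * s ^+ 2.
  rewrite ler_pdivlMl // expr2 mulrA ler_wpM2r //; lra.
apply: le_trans h1; rewrite mulrA ler_wpM2r //; lra.
Qed.

(** Each term of [split_error] gets half of [2 ^- i]. Since [(2 / 3) ^+ 2 <= 1 / 2], the depth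
    [2 * (i + 3)] settles the linear term; then [n] is taken large against the constant one. *)
Lemma split_small l i : exists K n, (0 < n)%N /\ split_error R l K n / n%:R <= 2 ^- i.
Proof.
pose K := (2 * (i + 3))%N; pose A := split_const l K.
exists K, (A * 2 ^ i.+1).+1; split=> //.
set n := _.+1.
have n0 : 0 < n%:R :> R by rewrite ltr0n.
have p0 : 0 < 2 ^+ i :> R by rewrite exprn_gt0.
rewrite ler_pdivrMr // /split_error -/A /= -/n.
have h1 : (2 / 3 : R) ^+ K <= 2 ^- i / 8.
  rewrite /K exprM (_ : 2 ^- i / 8 = (1 / 2) ^+ (i + 3)); last first.
    by rewrite exprD expr_div_n expr1n; field; rewrite expf_eq0 /=; lra.
  by apply: lerXn2r; rewrite ?nnegrE; lra.
have h2 : A%:R * 2 ^+ i.+1 <= n%:R :> R by rewrite -natrX -natrM ler_nat /n.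
have h3 : A%:R <= 2 ^- i / 2 * n%:R :> R.
  rewrite (_ : 2 ^- i / 2 = (2 ^+ i.+1)^-1); last by rewrite exprS invfM mulrC.
  by rewrite ler_pdivlMl ?exprn_gt0 // mulrC.
have h4 : 3 * (2 / 3) ^+ K * n%:R <= 2 ^- i / 2 * n%:R :> R.
  rewrite ler_wpM2r ?(ltW n0) //.
  have : 0 < 2 ^- i :> R by rewrite invr_gt0.
  lra.
lra.
Qed.

End Thresholds.

Lemma sum_indicator_le (R : numDomainType) (l : seq nat) B : uniq l ->
  \sum_(m <- l) (m < B)%N%:R <= B%:R :> R.
Proof.
move=> ul; rewrite -natr_sum ler_nat -[leqRHS](size_iota 0).
rewrite -big_mkcond /= sum1_count -size_filter.
apply: uniq_leq_size; first exact: filter_uniq.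
by move=> m; rewrite mem_filter mem_iota => /andP[].
Qed.

(** * Upper estimate for combinations of averages *)

Section UpperEstimate.
Variable R : realType.
Local Notation f := (@schlumprecht_f R).
Variable N : c00 R -> R.
Hypothesis normN : is_norm N.
Hypothesis eqnN : schlumprecht_equation N.
Implicit Types (u v x : c00 R).

Definition supp_in (lo hi : nat) u := forall m, u m != 0 -> (lo <= m < hi)%N.

Definition sep u v : bool := `[< forall m m', u m != 0 -> v m' != 0 -> (m < m')%N >].

Definition average (us : seq (c00 R)) : c00 R := (size us)%:R^-1 *: \sum_(u <- us) u.

Lemma c00_scaleE (r : R) x m : (r *: x) m = r * x m. Proof. by []. Qed.

Lemma c00_addE x y m : (x + y) m = x m + y m. Proof. by []. Qed.

Lemma c00_sumE (I : Type) (r : seq I) (P : pred I) (F : I -> c00 R) m :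
  (\sum_(i <- r | P i) F i) m = \sum_(i <- r | P i) F i m.
Proof. by elim/big_rec2: _ => //= i x y _ <-. Qed.

Variables (L K M : nat -> nat) (U : nat -> seq (c00 R)).
Hypothesis L0 : forall i, (0 < L i)%N.
Hypothesis Lmono : forall i j, (i <= j)%N -> (L i <= L j)%N.
Hypothesis L_growth : forall i l, (L i < l)%N -> decay R i.+1 * growth R l <= decay R i * f l.
Hypothesis L_tiny : forall i l, (L i.+1 < l)%N -> (M i.+1 * size (U i))%:R <= f l.
Hypothesis Mmono : forall i j, (i <= j)%N -> (M i <= M j)%N.
Hypothesis U0 : forall i, (0 < size (U i))%N.
Hypothesis Usupp : forall i u, u \in U i -> supp_in (M i) (M i.+1) u.
Hypothesis Usep : forall i, pairwise sep (U i).
Hypothesis U1 : forall i u, u \in U i -> N u <= 1.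
Hypothesis Usplit : forall i,
  split_error R (L i) (K i) (size (U i)) / (size (U i))%:R <= 2 ^- i.

(** Every block is tagged with the index of its average; the positions in this list are the atoms of
    [reduce_tree]. *)
Definition atoms (I : nat) : seq (nat * c00 R) :=
  flatten [seq [seq (i, u) | u <- U i] | i <- iota 0 I].

Lemma atomsS I : atoms I.+1 = atoms I ++ [seq (I, u) | u <- U I].
Proof. by rewrite /atoms -addn1 iotaD map_cat flatten_cat /= cats0. Qed.

Lemma atomsP I p : p \in atoms I -> (p.1 < I)%N /\ p.2 \in U p.1.
Proof.
move=> /flatten_mapP[i]; rewrite mem_iota add0n => /andP[_ iI] /mapP[u uU ->].
by [].
Qed.

Definition atom_rel (p q : nat * c00 R) := (p.1 <= q.1)%N && sep p.2 q.2.

Lemma atoms_rel I : pairwise atom_rel (atoms I).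
Proof.
elim: I => [|I IH] //; rewrite atomsS pairwise_cat IH andTb; apply/andP; split.
  apply/allrelP => p q /atomsP[pI pU] /mapP[u uU ->]; rewrite /atom_rel /= (ltnW pI) /=.
  apply/asboolP => m m' hm hm'.
  have /andP[_ h] := Usupp pU hm; have /andP[h' _] := Usupp uU hm'.
  by apply: leq_trans h _; apply: leq_trans h'; apply: Mmono.
rewrite pairwise_map; apply: sub_pairwise (Usep I) => u v /= uv.
by rewrite /atom_rel /= leqnn.
Qed.

Lemma sum_atoms I (F : nat -> c00 R -> R) :
  \sum_(p <- atoms I) F p.1 p.2 = \sum_(i < I) \sum_(u <- U i) F i u.
Proof.
rewrite /atoms big_flatten /= big_map -{1}[I]subn0 -/(index_iota 0 I) big_mkord.
by apply: eq_bigr => i _; rewrite big_map.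
Qed.

(** The constant is 8 = 6 + 2. The reduced tree is a forest of length 1, where [decay 0 = 2] and
    [growth 1 = 3]; the splitting error of the average [i] is at most [2 ^- i * N a], and these sum
    to at most [2 * N a]. *)
Lemma upper_estimate (a : c00 R) I :
  (forall i, (I <= i)%N -> a i = 0) ->
  N (\sum_(i < I) a i *: average (U i)) <= 8 * N a.
Proof.
move=> aI; apply: N_le_trees => // phi pphi sphi.
pose n i := size (U i).
have nR i : 0 < (n i)%:R :> R by rewrite ltr0n; exact: U0.
pose c i : R := `|a i| / (n i)%:R.
have c0 i : 0 <= c i by rewrite divr_ge0 // ltW.
pose at_ := atoms I.
pose Q := size at_.
pose p0 : nat * c00 R := (0%N, 0).
pose kap (q : 'I_Q) := (nth p0 at_ q).1.
pose u (q : 'I_Q) := absf (nth p0 at_ q).2.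
have atq (q : 'I_Q) : nth p0 at_ q \in atoms I by apply: mem_nth.
have relq (p q : 'I_Q) : (p < q)%N -> atom_rel (nth p0 at_ p) (nth p0 at_ q).
  by move=> pq; have /(pairwiseP p0) h := atoms_rel I; apply: h => //; rewrite inE.
have h1 : teval phi (absf (\sum_(i < I) a i *: average (U i))) <=
    \sum_(q < Q) c (kap q) * teval phi (u q).
  have -> : \sum_(q < Q) c (kap q) * teval phi (u q) =
      \sum_(i < I) \sum_(v <- U i) c i * teval phi (absf v).
    rewrite -(sum_atoms I (fun i v => c i * teval phi (absf v))).
    by rewrite (big_nth p0) big_mkord.
  have -> : \sum_(i < I) \sum_(v <- U i) c i * teval phi (absf v) =
      teval phi (fun m => \sum_(i < I) \sum_(v <- U i) c i * absf v m).
    rewrite eval_sum; apply: eq_bigr => i _; rewrite eval_sum; apply: eq_bigr => v _.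
    by rewrite eval_scale.
  apply: eval_le => m _; rewrite /absf c00_sumE.
  apply: le_trans (ler_norm_sum _ _ _) _; apply: ler_sum => i _.
  rewrite /average !c00_scaleE c00_sumE -/(n i).
  rewrite !normrM -mulr_sumr /c -mulrA ler_wpM2l // normfV normr_nat.
  by rewrite ler_wpM2l ?invr_ge0 ?(ltW (nR i)) // ler_norm_sum.
apply: le_trans h1 _.
have countE i : #|[pred q : 'I_Q | kap q == i]| = count (fun p => p.1 == i) at_.
  by rewrite -sum1_card -sum1_count (big_nth p0) big_mkord; apply: eq_bigl.
have countI i : count (fun p : nat * c00 R => p.1 == i) at_ = if (i < I)%N then n i else 0%N.
  rewrite /at_; elim: (I) => [|J IH] //; rewrite atomsS count_cat IH count_map.
  have [iJ|Ji|->] := ltngtP i J.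
  - rewrite ltnS ltnW // (eq_count (a2 := pred0)) ?count_pred0 ?addn0 // => v /=.
    by rewrite gtn_eqF.
  - rewrite ltnS leqNgt Ji /= (eq_count (a2 := pred0)) ?count_pred0 ?addn0 // => v /=.
    by rewrite ltn_eqF.
  - rewrite ltnS leqnn (eq_count (a2 := predT)) ?count_predT // => v /=.
    by rewrite eqxx.
have u1 (q : 'I_Q) : N (nth p0 at_ q).2 <= 1.
  by have [_ h] := atomsP (atq q); exact: U1 h.
have u_ge0 q m : 0 <= u q m by rewrite /u absf_ge0.
have mono (p q : 'I_Q) : (p <= q)%N -> (kap p <= kap q)%N.
  by rewrite leq_eqVlt => /predU1P[/val_inj -> //|/relq /andP[]].
have succ (p q : 'I_Q) m m' : (p < q)%N -> u p m != 0 -> u q m' != 0 -> (m < m')%N.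
  by rewrite /u /absf !normr_eq0 => /relq /andP[_ /asboolP]; apply.
have le1 (q : 'I_Q) t : pure t -> succ_tree t -> teval t (u q) <= 1.
  by move=> pt st; apply: le_trans (eval_le_N normN eqnN _ pt st) (u1 q).
(* The entries of an atom are at most 1 and vanish from [M (kap q).+1] on. *)
have l1 (q : 'I_Q) (l : seq nat) : uniq l -> \sum_(m <- l) u q m <= (M (kap q).+1)%:R.
  move=> ul; have [_ qU] := atomsP (atq q).
  have hu (m : nat) : u q m <= (m < M (kap q).+1)%N%:R.
    case: ltnP => hm; first exact: le_trans (N_coord eqnN _ _) (u1 q).
    rewrite le_eqVlt; apply/orP; left; apply/eqP; rewrite /u /absf.
    apply/eqP; rewrite normr_eq0; apply/negP => /negP /(Usupp qU) /andP[_].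
    by rewrite ltnNge hm.
  apply: (@le_trans _ _ (\sum_(m <- l) (m < M (kap q).+1)%N%:R)); first exact: ler_sum.
  exact: sum_indicator_le.
have nkap i : (#|[pred q : 'I_Q | kap q == i]| <= n i)%N.
  by rewrite countE countI; case: ifP => // _; exact: leq0n.
have tiny i j l : (i < j)%N -> (L j < l)%N -> (M i.+1)%:R * (n i)%:R <= f l.
  move=> ij Ll; rewrite -natrM; apply: L_tiny.
  by apply: leq_ltn_trans Ll; exact: Lmono.
have [t [adm st _ ht]] := @reduce_tree R L Q I kap u (fun i => (M i.+1)%:R) n c L0 Lmono
  (fun q => (atomsP (atq q)).1) mono u_ge0 succ le1 l1 nkap tiny c0 phi [set: 'I_Q]%SET K pphi sphi.
have cntE i : cnt kap [set: 'I_Q]%SET i = if (i < I)%N then n i else 0%N.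
  rewrite -countI -countE /cnt; apply: eq_card => q; by rewrite !inE.
have cn i : c i * (n i)%:R = `|a i| by rewrite /c divfK // gt_eqF.
rewrite (eq_bigl (fun q => q \in [set: 'I_Q]%SET)); last by move=> q; rewrite inE.
apply: le_trans ht _.
have -> : teval t (fun i => c i * (cnt kap [set: 'I_Q]%SET i)%:R) = teval t (absf a).
  apply: eval_ext => i _; rewrite cntE /absf; case: ltnP => [_|/aI ->]; first exact: cn.
  by rewrite mulr0 normr0.
have h2 : teval t (absf a) <= 6 * N a.
  have := @forest_estimate R N normN eqnN L (decay R) (@decay_ge1 R) (@decay_dec R) L_growth
     [:: t] 0 a.
  rewrite /= adm /eval_forest big_seq1 /succ_forest /forest_leaves /= cats0.
  move=> /(_ isT st (fun _ _ => isT)) h; apply: le_trans h _.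
  rewrite ler_wpM2r ?N_ge0 // /growth f1 /decay expr0 invr1 sqrtr1.
  rewrite min_l; lra.
have h3 : \sum_(i < I) c i * split_error R (L i) (K i) (cnt kap [set: 'I_Q]%SET i) <= 2 * N a.
  apply: (@le_trans _ _ (\sum_(i < I) 2 ^- i * N a)).
    apply: ler_sum => i _; rewrite cntE ltn_ord /c mulrAC -mulrA [leLHS]mulrC.
    by apply: ler_pM => //; [rewrite divr_ge0 ?split_error_ge0 // ltW | exact: N_coord].
  rewrite -mulr_suml ler_wpM2r ?N_ge0 //.
  have e : \sum_(i < I) 2 ^- i = 2 - 2 * 2 ^- I :> R.
    elim: (I) => [|J IH]; first by rewrite big_ord0 expr0 invr1; ring.
    by rewrite big_ord_recr /= IH exprS; field; rewrite expf_eq0 /=; lra.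
  have : 0 < 2 ^- I :> R by rewrite invr_gt0 exprn_gt0.
  rewrite e; lra.
lra.
Qed.

End UpperEstimate.

(** * Averages in block subspaces *)

Section James.
Variable R : realType.
Local Notation f := (@schlumprecht_f R).
Variable N : c00 R -> R.
Hypothesis normN : is_norm N.
Hypothesis eqnN : schlumprecht_equation N.
Implicit Types (u v x w : c00 R).

Lemma f_pow n k : (0 < k)%N -> f (n ^ k) <= k%:R * f n.
Proof.
case: k => // k _; rewrite /schlumprecht_f mulrA ler_wpM2r ?invr_ge0 ?(ltW (ln2_gt0 R)) //.
rewrite mulr_natl -lnXn ?ltr0n // ln_mono ?ltr0n // -natrX ler_nat.
elim: k => // k IH; rewrite expnS [X in (_ <= X)%N]expnS.
have : (0 < n.+1 ^ k.+1)%N by rewrite expn_gt0.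
by move: IH; nia.
Qed.

Lemma pow2_beats (A : R) : exists2 k, (0 < k)%N & A * k%:R < 2 ^+ k / 2.
Proof.
(* With [4 * A < p <= 2 ^+ p] one gets [A * (2 * p) < p ^+ 2 / 2 <= 2 ^+ (2 * p) / 2]. *)
pose p := (Num.truncn `|4 * A|).+1.
have Ap : 4 * A < p%:R by apply: le_lt_trans (ler_norm _) (truncnS_gt _).
exists (2 * p)%N; first by rewrite /p.
have pp : p%:R <= 2 ^+ p :> R by rewrite -natrX ler_nat ltnW // ltn_expl.
have p0 : 0 < p%:R :> R by rewrite ltr0n.
rewrite mulnC exprM natrM expr2; nra.
Qed.

Lemma eval_forest_le s x : (0 < size s)%N -> all pure s -> succ_forest s ->
  eval_forest s (absf x) <= f (size s) * N x.
Proof.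
move=> s0 /allP ps ss.
have := @N_pieces _ N normN eqnN (map leaves s) x; rewrite size_map => /(_ s0 ss) h.
apply: le_trans h; rewrite big_map /eval_forest big_seq [leRHS]big_seq.
apply: ler_sum => t ts; rewrite restr_leaves_eval; apply: eval_le_N => //; first exact: ps.
exact: succ_forest_tree ss ts.
Qed.

Lemma eval_forest_cat s s' (b : nat -> R) :
  eval_forest (s ++ s') b = eval_forest s b + eval_forest s' b.
Proof. by rewrite /eval_forest big_cat. Qed.

Lemma forest_leaves_catP s s' : succ_forest s -> succ_forest s' ->
  (forall a b, a \in forest_leaves s -> b \in forest_leaves s' -> (a < b)%N) ->
  succ_forest (s ++ s').
Proof.
rewrite /succ_forest forest_leaves_cat !(sorted_pairwise ltn_trans) pairwise_cat.
by move=> -> -> h; rewrite !andbT; apply/allrelP => a b; apply: h.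
Qed.

Lemma norming_tree lo hi x (c : R) : supp_in lo hi x -> c < N x ->
  exists t, [/\ pure t, succ_tree t, forall i, i \in leaves t -> (lo <= i < hi)%N &
    c < teval t (absf x)].
Proof.
move=> sx cN.
have [t [pt st ct]] : exists t, [/\ pure t, succ_tree t & c < teval t (absf x)].
  apply: contrapT => hn; have : N x <= c.
    apply: N_le_trees => // t pt st; rewrite leNgt; apply/negP => h.
    by apply: hn; exists t.
  by rewrite leNgt cN.
exists (tree_restr (fun i => (lo <= i < hi)%N) t); split.
- exact: pure_restr.
- exact: succ_restr.
- by move=> i; rewrite leaves_restr mem_filter => /andP[].
rewrite eval_restr; apply: lt_le_trans ct _; apply: eval_le => i _.
case: ifPn => // hi'; rewrite /absf; have [->|/sx h] := eqVneq (x i) 0; first by rewrite normr0.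
by rewrite h in hi'.
Qed.

(** [approx d u] abstracts that [u] lies within [d] of the given subspace; the hypotheses say how
    the error behaves under averaging. *)
Variable approx : R -> c00 R -> Prop.
Hypothesis approx0 : approx 0 0.
Hypothesis approx_add : forall d e u v, approx d u -> approx e v -> approx (d + e) (u + v).
Hypothesis approx_scale : forall d (a : R) u, 0 <= a -> approx d u -> approx (a * d) (a *: u).
Hypothesis approx_le : forall d e u, d <= e -> approx d u -> approx e u.
Hypothesis blocks : forall lo (d : R), 0 < d -> exists hi w,
  [/\ supp_in lo hi w, N w <= 1, 3 / 4 <= N w & approx d w].

Definition l1_average (n lo hi : nat) (d : R) (us : seq (c00 R)) : Prop :=
  [/\ size us = n, forall u, u \in us -> supp_in lo hi u /\ N u <= 1,
      pairwise (@sep R) us, 1 / 2 <= N (average us) & approx d (average us)].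

(** [w] is the result of [j] rounds of replacing [n] blocks by twice their
    average, together with a forest witnessing that it is large. *)
Definition james_step (n j lo hi : nat) (d : R) (m : nat) (w : c00 R) : Prop :=
  [/\ (lo <= hi)%N, supp_in lo hi w, approx d w &
   exists s, [/\ size s = (m * n ^ j)%N, all pure s, succ_forest s,
     forall i, i \in forest_leaves s -> (lo <= i < hi)%N &
     m%:R * (2 ^+ j / 2) <= eval_forest s (absf w)]].

Lemma supp_in_coord lo hi w i : supp_in lo hi w -> ~~ (lo <= i < hi)%N -> w i = 0.
Proof. by move=> h hi'; apply/eqP/negP => /negP /h; rewrite (negbTE hi'). Qed.

Lemma supp_in_lt lo hi w : supp_in lo hi w -> 0 < N w -> (lo < hi)%N.
Proof.
move=> sw w0; rewrite ltnNge; apply/negP => hl.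
suff w00 : w = 0 by rewrite w00 (N0 normN) ltxx in w0.
apply: c00_ext => i; apply: (supp_in_coord sw).
by apply/negP => /andP[h1 h2]; have := leq_ltn_trans h1 h2; rewrite ltnNge hl.
Qed.

(** Vectors are appended one after the other to the right and their witnessing forests concatenated;
    on the leaves of either forest the other summand vanishes, so the values add up. *)
Lemma james_sum n j d lo0 : 0 <= d ->
  (forall lo, (lo0 <= lo)%N -> exists hi w, james_step n j lo hi d 1 w /\ N w <= 1) ->
  forall m lo, (lo0 <= lo)%N -> exists hi (ws : seq (c00 R)),
  [/\ size ws = m, forall u, u \in ws -> supp_in lo hi u /\ N u <= 1,
      pairwise (@sep R) ws & james_step n j lo hi (m%:R * d) m (\sum_(u <- ws) u)].
Proof.
move=> d0 h; elim=> [|m IH] lo ll.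
  exists lo, [::]; split=> //; split=> //.
  - by move=> i; rewrite big_nil eqxx.
  - by rewrite big_nil mul0r.
  - by exists [::]; split=> //; rewrite /eval_forest big_nil mul0r.
have [mid [ws [sws hws pws [lm sw aw [s [ss ps succ_s ls es]]]]]] := IH lo ll.
have [hi [w [[mh sw' aw' [s' [ss' ps' succ_s' ls' es']]] Nw]]] := h mid (leq_trans ll lm).
exists hi, (rcons ws w).
have sum_rcons : \sum_(u <- rcons ws w) u = \sum_(u <- ws) u + w.
  by rewrite -cats1 big_cat big_seq1.
split.
- by rewrite size_rcons sws.
- move=> u; rewrite mem_rcons inE => /predU1P[->|/hws[su Nu]]; split=> // i.
    by move=> /sw' /andP[mi ih]; rewrite ih (leq_trans lm mi).
  by move=> /su /andP[li im]; rewrite li (leq_trans im mh).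
- rewrite -cats1 pairwise_cat pws /= !andbT; apply/allrelP => u v /hws[su _].
  rewrite inE => /eqP ->; apply/asboolP => i k /su /andP[_ im] /sw' /andP[mk _].
  exact: leq_trans im mk.
- rewrite sum_rcons; split.
  + exact: leq_trans lm mh.
  + move=> i; rewrite c00_addE; have [im|mi] := ltnP i mid.
      rewrite (supp_in_coord sw') ?addr0; last by rewrite negb_and -ltnNge im.
      by move=> /sw /andP[-> _]; rewrite (leq_trans im mh).
    rewrite (supp_in_coord sw) ?add0r; last by rewrite negb_and -leqNgt mi orbT.
    by move=> /sw' /andP[_ ->]; rewrite (leq_trans lm mi).
  + by rewrite -addn1 natrD mulrDl mul1r; exact: approx_add.
  exists (s ++ s'); split.
  + by rewrite size_cat ss ss' mul1n mulSn addnC.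
  + by rewrite all_cat ps ps'.
  + apply: forest_leaves_catP => // a b /ls /andP[_ am] /ls' /andP[mb _].
    exact: leq_trans am mb.
  + move=> i; rewrite forest_leaves_cat mem_cat => /orP[/ls|/ls'] /andP[h1 h2].
      by rewrite h1 (leq_trans h2 mh).
    by rewrite (leq_trans lm h1).
  rewrite eval_forest_cat -addn1 natrD mulrDl; apply: lerD.
    apply: le_trans es _; rewrite le_eqVlt; apply/orP; left; apply/eqP.
    apply: eq_big_seq => t ts; apply: eval_ext => i it.
    have /andP[_ im] : (lo <= i < mid)%N by apply: ls; apply/mem_forest_leaves; exists t.
    by rewrite /absf c00_addE (supp_in_coord sw') ?addr0 // negb_and -ltnNge im.
  apply: le_trans es' _; rewrite le_eqVlt; apply/orP; left; apply/eqP.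
  apply: eq_big_seq => t ts; apply: eval_ext => i it.
  have /andP[mi _] : (mid <= i < hi)%N by apply: ls'; apply/mem_forest_leaves; exists t.
  by rewrite /absf c00_addE (supp_in_coord sw) ?add0r // negb_and -leqNgt mi orbT.
Qed.

(** If every average had norm below [1 / 2], averages could be doubled and averaged again. After [k]
    rounds a vector of norm at most 1 would have a forest of [n ^ k] trees with value [2 ^+ k / 2],
    but such a value is at most [f (n ^ k) <= k * f n]. *)
Lemma james n lo d : (0 < n)%N -> 0 < d -> exists hi us, l1_average n lo hi d us.
Proof.
move=> n0 d0; apply: contrapT => hn.
have fail lo' hi us : (lo <= lo')%N -> ~ l1_average n lo' hi d us.
  move=> ll [h1 h2 h3 h4 h5]; apply: hn; exists hi, us; split=> // u /h2[su Nu]; split=> // i.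
  by move=> /su /andP[li ->]; rewrite (leq_trans ll li).
have [k k0 hk] := pow2_beats (f n).
(* Each of the [k] doublings doubles the distance to the subspace. *)
pose d' := d / 2 ^+ k.
have p0 : 0 < 2 ^+ k :> R by rewrite exprn_gt0.
have d'0 : 0 < d' by rewrite divr_gt0.
have nR : 0 < n%:R :> R by rewrite ltr0n.
have steps j : (j <= k)%N -> forall lo', (lo <= lo')%N ->
    exists hi w, james_step n j lo' hi (2 ^+ j * d') 1 w /\ N w <= 1.
  elim: j => [_|j IH jk] lo' ll.
    have [hi [w [sw Nw1 Nw2 aw]]] := blocks lo' d'0.
    have [t [pt st lt ht]] : exists t, [/\ pure t, succ_tree t,
        forall i, i \in leaves t -> (lo' <= i < hi)%N & 1 / 2 < teval t (absf w)].
      by apply: norming_tree => //; lra.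
    exists hi, w; split=> //; split.
    - by apply/ltnW/(supp_in_lt sw); lra.
    - by [].
    - by rewrite expr0 mul1r.
    - exists [:: t]; split=> //=.
      + by rewrite pt.
      + by rewrite /succ_forest /forest_leaves /= cats0.
      + by rewrite /forest_leaves /= cats0.
      + by rewrite /eval_forest big_seq1 expr0; lra.
  have dj0 : 0 <= 2 ^+ j * d' by rewrite mulr_ge0 ?exprn_ge0 // ltW.
  have [hi [ws [sws hws pws [lh sw aw [s [ss ps succ_s ls es]]]]]] :=
    james_sum dj0 (IH (ltnW jk)) n ll.
  have avE : average ws = n%:R^-1 *: \sum_(u <- ws) u by rewrite /average sws.
  have app : approx (2 ^+ j * d') (average ws).
    rewrite avE (_ : 2 ^+ j * d' = n%:R^-1 * (n%:R * (2 ^+ j * d'))); last first.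
      by rewrite mulKf // gt_eqF.
    by apply: approx_scale => //; rewrite invr_ge0 ltW.
  have small : N (average ws) < 1 / 2.
    rewrite ltNge; apply/negP => big; apply: (fail lo' hi ws ll); split=> //.
    apply: approx_le app; rewrite /d' mulrCA ler_piMr ?(ltW d0) // ler_pdivrMr // mul1r.
    by rewrite ler_eXn2l ?ltr1n // ltnW.
  exists hi, (2 *: average ws); split.
    split=> //.
    - by move=> i; rewrite avE !c00_scaleE !mulf_eq0 !negb_or => /and3P[_ _ /sw].
    - by rewrite exprS -mulrA; exact: approx_scale.
    exists s; split=> //.
      by rewrite ss mul1n expnS.
    have -> : eval_forest s (absf (2 *: average ws)) =
        2 / n%:R * eval_forest s (absf (\sum_(u <- ws) u)).
      rewrite /eval_forest mulr_sumr; apply: eq_bigr => t _; rewrite -eval_scale.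
      apply: eval_ext => i _; rewrite avE /absf !c00_scaleE !normrM normfV !normr_nat.
      by rewrite mulrA.
    apply: (@le_trans _ _ (2 / n%:R * (n%:R * (2 ^+ j / 2)))).
      rewrite le_eqVlt; apply/orP; left; apply/eqP; rewrite exprS; field.
      by rewrite gt_eqF.
    by rewrite ler_wpM2l // divr_ge0 // ltW.
  by case: normN => _ hN _; rewrite hN normr_nat; lra.
have [hi [w [[_ _ _ [s [ss ps succ_s _ es]]] Nw]]] := steps k (leqnn k) lo (leqnn lo).
have s0 : (0 < size s)%N by rewrite ss mul1n expn_gt0 n0.
have h1 := eval_forest_le w s0 ps succ_s.
have h2 : f (size s) * N w <= k%:R * f n.
  rewrite ss mul1n; apply: le_trans (f_pow n k0).
  by rewrite ler_piMr ?f_ge0.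
lra.
Qed.

End James.

(** * Inductive choice of the parameters *)

Section Selection.
Variable R : realType.
Local Notation f := (@schlumprecht_f R).
Variable N : c00 R -> R.
Hypothesis normN : is_norm N.
Hypothesis eqnN : schlumprecht_equation N.
Variable approx : R -> c00 R -> Prop.
Hypothesis averages : forall n lo d, (0 < n)%N -> 0 < d ->
  exists hi us, l1_average N approx n lo hi d us.

Record block_sequence (L K M : nat -> nat) (U : nat -> seq (c00 R)) : Prop := {
  bs_L0 : forall i, (0 < L i)%N ;
  bs_Lmono : forall i j, (i <= j)%N -> (L i <= L j)%N ;
  bs_growth : forall i l, (L i < l)%N -> decay R i.+1 * growth R l <= decay R i * f l ;
  bs_tiny : forall i l, (L i.+1 < l)%N -> (M i.+1 * size (U i))%:R <= f l ;
  bs_M : forall i, (M i < M i.+1)%N ;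
  bs_U0 : forall i, (0 < size (U i))%N ;
  bs_supp : forall i u, u \in U i -> supp_in (M i) (M i.+1) u ;
  bs_sep : forall i, pairwise (@sep R) (U i) ;
  bs_le1 : forall i u, u \in U i -> N u <= 1 ;
  bs_split : forall i,
    split_error R (L i) (K i) (size (U i)) / (size (U i))%:R <= 2 ^- i ;
  bs_ge : forall i, 1 / 2 <= N (average (U i)) ;
  bs_approx : forall i, approx (2 ^- (i + 6)) (average (U i)) }.

Lemma average_supp lo hi (us : seq (c00 R)) :
  (forall u, u \in us -> supp_in lo hi u) -> supp_in lo hi (average us).
Proof.
move=> h m; rewrite /average c00_scaleE mulf_eq0 negb_or => /andP[_].
move=> hm; apply: contrapT => out; move/eqP: hm; apply.
rewrite c00_sumE big_seq big1 // => u /h hu; apply/eqP/negP => /negP /hu.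
by move/negP: out => /negbTE ->.
Qed.

(** At stage [i] the threshold [L i] comes first, with regard to the blocks already chosen; [K i]
    and the length of the average follow from [L i] by [split_small], and the average itself is
    taken beyond [M i]. *)
Lemma selection : exists L K M U, block_sequence L K M U.
Proof.
(* The input [p] holds the index, the left end of the next support, the previous threshold and the
   number [W] that [f] must reach beyond the new threshold; [q] holds the new threshold, depth,
   blocks and right end. *)
pose good (p : nat * nat * nat * nat) (q : nat * nat * seq (c00 R) * nat) : Prop :=
  let: (i, M0, Lp, W) := p in let: (l, k, us, M1) := q in
  [/\ ((Lp <= l)%N /\ (0 < l)%N),
      (forall l', (l < l')%N ->
        decay R i.+1 * growth R l' <= decay R i * f l' /\ W%:R <= f l'),
      ((M0 < M1)%N /\ (0 < size us)%N),
      split_error R l k (size us) / (size us)%:R <= 2 ^- i &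
      l1_average N approx (size us) M0 M1 (2 ^- (i + 6)) us].
have step p : exists q, good p q.
  case: p => [[[i M0] Lp] W].
  have [l1 h1] := growth_large R i.
  have [l2 h2] := f_large (W%:R : R).
  pose l := maxn Lp (maxn 1 (maxn l1 l2)).
  have [k [n [n0 hn]]] := split_small R l i.
  have d0 : 0 < 2 ^- (i + 6) :> R by rewrite invr_gt0 exprn_gt0.
  have [M1 [us av]] := averages M0 n0 d0.
  have [sus hus _ big _] := av.
  exists (l, k, us, M1); split.
  - by rewrite /l !leq_max leqnn /= orbT.
  - move=> l' ll; split; [apply: h1|apply: h2]; apply: leq_ltn_trans ll;
      by rewrite /l !leq_max leqnn !orbT.
  - split; last by rewrite sus.
    have sup : supp_in M0 M1 (average us) by apply: average_supp => u /hus[].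
    by apply: (supp_in_lt normN sup); lra.
  - by rewrite sus.
  - by rewrite sus.
have [F hF] := choice step.
pose next (i : nat) (q : nat * nat * seq (c00 R) * nat) : nat * nat * nat * nat :=
  let: (l, k, us, M1) := q in (i, M1, l, M1 * size us)%N.
pose st := fix st i : nat * nat * seq (c00 R) * nat :=
  if i is i'.+1 then F (next i (st i')) else F (0, 0, 0, 0)%N.
pose L i := (st i).1.1.1; pose K i := (st i).1.1.2; pose U i := (st i).1.2.
pose M i := if i is i'.+1 then (st i').2 else 0%N.
have stE i : st i = (L i, K i, U i, M i.+1).
  by rewrite /L /K /U /M; case: (st i) => [[[]]].
pose prev i := if i is i'.+1 then (L i', M i * size (U i'))%N else (0, 0)%N.
have H i : good (i, M i, (prev i).1, (prev i).2) (L i, K i, U i, M i.+1).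
  rewrite -stE; case: i => [|i]; first exact: hF.
  have := hF (next i.+1 (st i)); rewrite /= /next stE /=.
  by [].
exists L, K, M, U; split=> i.
- by have [[]] := H i.
- move=> j; elim: j => [|j IH]; first by rewrite leqn0 => /eqP ->.
  rewrite leq_eqVlt => /predU1P[-> //|]; rewrite ltnS => /IH h.
  by apply: leq_trans h _; have [[]] := H j.+1.
- by have [_ h _ _ _] := H i; move=> l /h[].
- by have [_ h _ _ _] := H i.+1; move=> l /h[].
- by have [_ _ []] := H i.
- by have [_ _ []] := H i.
- by have [_ _ _ _ [_ h _ _ _]] := H i; move=> u /h[].
- by have [_ _ _ _ [_ _ h _ _]] := H i.
- by have [_ _ _ _ [_ h _ _ _]] := H i; move=> u /h[].
- by have [_ _ _ h _] := H i.
- by have [_ _ _ _ [_ _ _ h _]] := H i.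
- by have [_ _ _ _ [_ _ _ _ h]] := H i.
Qed.

End Selection.

(** * A left inverse on the block sequence *)

Section Projection.
Variable R : realType.
Variable N : c00 R -> R.
Hypothesis normN : is_norm N.
Hypothesis eqnN : schlumprecht_equation N.
Variables (M : nat -> nat) (y : nat -> c00 R).
Hypothesis M_lt : forall i, (M i < M i.+1)%N.
Hypothesis y_supp : forall i, supp_in (M i) (M i.+1) (y i).
Hypothesis y_ge : forall i, 1 / 2 <= N (y i).

Lemma M_ge i : (i <= M i)%N.
Proof. by elim: i => // i IH; exact: leq_ltn_trans IH (M_lt i). Qed.

Lemma M_mono i j : (i <= j)%N -> (M i <= M j)%N.
Proof.
elim: j => [|j IH]; first by rewrite leqn0 => /eqP ->.
rewrite leq_eqVlt => /predU1P[-> //|]; rewrite ltnS => /IH h.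
by apply: leq_trans h (ltnW (M_lt j)).
Qed.

(** Substituting norming trees of the [y i] for the leaves of a tree bounds [Q]. *)
Lemma coefficient_map : exists Q : c00 R -> c00 R,
  [/\ forall a u v, Q (a *: u + v) = a *: Q u + Q v,
      forall x, N (Q x) <= 4 * N x &
      forall i k, Q (y i) k = (k == i)%:R].
Proof.
have ht i : exists t, [/\ pure t, succ_tree t,
    forall m, m \in leaves t -> (M i <= m < M i.+1)%N & 1 / 4 < teval t (absf (y i))].
  by apply: (norming_tree normN eqnN (@y_supp i)); have := y_ge i; lra.
have [tau htau] := choice ht.
pose den i := teval (tau i) (absf (y i)).
have den4 i : 1 / 4 < den i by case: (htau i).
have den0 i : 0 < den i by have := den4 i; lra.
(* The signs give [psi i (y i) = 1], and [den i > 1 / 4] is the source of the constant 4. *)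
pose psi i (x : nat -> R) := teval (tau i) (fun m => Num.sg (y i m) * x m) / den i.
have psi_out i x : (forall m, (M i <= m < M i.+1)%N -> x m = 0) -> psi i x = 0.
  move=> h; rewrite /psi (_ : teval _ _ = 0) ?mul0r // -(eval0 R (tau i)).
  apply: eval_ext => m mt; rewrite h ?mulr0 //.
  by case: (htau i) => _ _ + _; apply.
have psi_le i x : `|psi i x| <= 4 * teval (tau i) (absf x).
  have h : `|teval (tau i) (fun m => Num.sg (y i m) * x m)| <= teval (tau i) (absf x).
    have sg1 m : `|Num.sg (y i m) * x m| <= `|x m|.
      by rewrite normrM normr_sg; case: (y i m != 0); rewrite ?mul1r ?mul0r.
    rewrite ler_norml; apply/andP; split; last first.
      by apply: eval_le => m _; apply: le_trans (ler_norm _) (sg1 m).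
    rewrite -mulN1r -eval_scale; apply: eval_le => m _; rewrite mulN1r /absf.
    by rewrite lerNl; apply: le_trans (sg1 m); rewrite -normrN ler_norm.
  rewrite /psi normrM normfV (gtr0_norm (den0 i)) ler_pdivrMr //.
  apply: le_trans h _; have := den4 i.
  have : 0 <= teval (tau i) (absf x) by apply: eval_ge0 => m; exact: absf_ge0.
  nra.
have Qfin (x : c00 R) : (fun i => psi i x) \in @finitely_supported R.
  have [B hB] := c00_bound x; apply/asboolP.
  apply: (@sub_finite_set _ _ `I_B) => [i /=|]; last exact: finite_II.
  move=> h; rewrite ltnNge; apply/negP => Bi; move/eqP: h; apply; apply: psi_out => m /andP[Mm _].
  by apply: hB; apply: leq_trans Mm; apply: leq_trans Bi (M_ge i).
pose Q (x : c00 R) := C00 (Qfin x).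
have QE x i : Q x i = psi i x by [].
exists Q; split.
- move=> a u v; apply: c00_ext => i; rewrite c00_addE c00_scaleE !QE.
  rewrite /psi mulrA -mulrDl -eval_lin; congr (_ / _); apply: eval_ext => m _.
  by rewrite c00_addE c00_scaleE; ring.
- move=> x; apply: N_le_trees => // phi pphi sphi.
  apply: (@le_trans _ _ (4 * teval (tree_subst tau phi) (absf x))).
    rewrite eval_subst // -eval_scale; apply: eval_le => i _; exact: psi_le.
  rewrite ler_wpM2l //; apply: eval_le_N => //.
    by apply: pure_subst => // i; case: (htau i).
  rewrite /succ_tree leaves_subst //; apply/sorted_flattenP; rewrite size_map.
  have nthE j : (j < size (leaves phi))%N ->
      nth [::] (map (leaves \o tau) (leaves phi)) j = leaves (tau (nth 0%N (leaves phi) j)).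
    by move=> jn; rewrite (nth_map 0%N).
  split=> [j jn|j k /andP[jk kn] a b].
    by rewrite nthE //; case: (htau (nth 0%N (leaves phi) j)).
  have jn := ltn_trans jk kn; rewrite !nthE //.
  have jk' : (nth 0%N (leaves phi) j < nth 0%N (leaves phi) k)%N.
    by apply: (sorted_ltn_nth ltn_trans) => //; rewrite inE.
  have [_ _ + _] := htau (nth 0%N (leaves phi) j) => /[apply] /andP[_ h1].
  have [_ _ + _] := htau (nth 0%N (leaves phi) k) => /[apply] /andP[h2 _].
  by apply: leq_trans h1 _; apply: leq_trans h2; apply: M_mono.
- move=> i k; rewrite QE; have [->|ki] := eqVneq k i.
    rewrite /psi /den (_ : teval _ _ = teval (tau i) (absf (y i))).
      by rewrite divff // gt_eqF //; exact: den0.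
    by apply: eval_ext => m _; rewrite /absf normrEsg.
  apply: psi_out => m /andP[km mk]; apply/eqP/negP => /negP /y_supp /andP[im mi].
  move: ki; rewrite neq_ltn => /orP[] lt.
    by have := M_mono lt; rewrite leqNgt (leq_ltn_trans im mk).
  by have := M_mono lt; rewrite leqNgt (leq_ltn_trans km mi).
Qed.

End Projection.

(** * From [c00] to the completion *)

Section NormedFacts.
Variable R : realType.

Lemma closure_near (X : normedModType R) (A : set X) (x : X) :
  closure A x <-> forall e, 0 < e -> exists2 y, A y & `|x - y| < e.
Proof.
split=> [cl e e0|h B].
  have [y [Ay By]] := cl _ (nbhsx_ballx x e e0); exists y => //.
  by move: By; rewrite -ball_normE.
move=> /nbhs_ballP[e /= e0 eB]; have [y Ay xy] := h e e0.
by exists y; split=> //; apply: eB; rewrite -ball_normE.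
Qed.

Lemma bounded_continuous (X W : normedModType R) (G : {linear X -> W}) (B : R) :
  (forall x, `|G x| <= B * `|x|) -> continuous G.
Proof.
move=> h; apply: bounded_linear_continuous; apply/linear_boundedP.
near=> r.
have Br : B <= r by near: r; apply: nbhs_pinfty_ge; rewrite ?num_real.
by move=> x; apply: le_trans (h x) _; rewrite ler_wpM2r.
Unshelve. all: by end_near. Qed.

(** Solving [V x = y] means finding a fixed point of [x |-> y + x - V x], a contraction with
    constant [1 / 2]. The bound of [x] by twice [V x] gives uniqueness, from which linearity and the
    norm of the inverse follow. *)
Lemma perturbation_inverse (X : completeNormedModType R) (V : {linear X -> X}) :
  (forall x, `|V x - x| <= 1 / 2 * `|x|) ->
  exists W : {linear X -> X}, [/\ forall y, V (W y) = y, forall x, W (V x) = x &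
    forall y, `|W y| <= 2 * `|y|].
Proof.
move=> hV.
have lower x : `|x| <= 2 * `|V x|.
  have h1 : `|x| <= `|V x| + `|V x - x|.
    rewrite -{1}[x](subKr (V x)); exact: ler_normB.
  have := hV x; lra.
have inj x x' : V x = V x' -> x = x'.
  move=> e; apply/eqP; rewrite -subr_eq0 -normr_le0; have := lower (x - x').
  by rewrite linearB e subrr normr0 mulr0.
have surj y : exists x, V x = y.
  pose g x := y + x - V x.
  pose gf : {fun [set: X] >-> [set: X]} :=
    HB.pack g (isFun.Build X X setT setT g (fun _ _ => I)).
  have half0 : 0 <= 1 / 2 :> R by lra.
  have ctr : is_contraction gf.
    exists (NngNum half0); split=> /=; first by lra.
    move=> [x x'] _ /=; rewrite /g.
    have -> : y + x - V x - (y + x' - V x') = - (V (x - x') - (x - x')).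
      rewrite -(addrA y x) -(addrA y x') opprD addrACA subrr add0r opprD opprK addrACA.
      by rewrite opprB linearB opprB [- V x + _]addrC.
    by rewrite normrN; exact: hV.
  have [p _ pE] := banach_fixed_point ctr closedT (ex_intro _ 0 I).
  exists p; move: pE; rewrite /= /g => e.
  by apply: (addIr (p - V p)); rewrite addrCA subrr addr0 addrA.
have [W hW] := choice surj.
have Wlin : linear W.
  by move=> a u v; apply: inj; rewrite linearP !hW.
pose Wl : {linear X -> X} := HB.pack W (GRing.isLinear.Build R X X *:%R W Wlin).
exists Wl; split=> [y|x|y] /=; first exact: hW.
  by apply: inj; rewrite hW.
by have := lower (W y); rewrite hW.
Qed.

(** The kernel has codimension at most 1 in [Y]: one vector [y0] with [phi y0 != 0], added to a
    spanning family of the kernel, spans [Y]. *)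
Lemma not_finite_dim_kernel (X : lmodType R) (Y : set X) (phi : X -> R) :
  (forall a u v, Y u -> Y v -> Y (a *: u + v)) ->
  (forall a u v, phi (a *: u + v) = a * phi u + phi v) ->
  ~ finite_dimensional Y -> ~ finite_dimensional (Y `&` [set y | phi y = 0]).
Proof.
move=> Ylin philin nfd [n [v hv]]; apply: nfd.
have [[y0 [Yy0 py0]]|none] := pselect (exists y, Y y /\ phi y != 0); last first.
  exists n, v => y Yy; apply: hv; split=> //=.
  by apply: contrapT => /eqP py; apply: none; exists y.
exists n.+1, (fun i => if unlift ord0 i is Some j then v j else y0) => y Yy.
pose c := phi y / phi y0.
have [d hd] : exists c' : 'I_n -> R, y - c *: y0 = \sum_(i < n) c' i *: v i.
  apply: hv; split.
    by rewrite addrC -scaleNr; exact: Ylin.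
  by rewrite /= addrC -scaleNr philin /c mulNr divfK // addNr.
exists (fun i => if unlift ord0 i is Some j then d j else c).
rewrite big_ord_recl unlift_none -[LHS](subrK (c *: y0)) hd addrC; congr (_ + _).
by apply: eq_bigr => i _; rewrite liftK.
Qed.
End NormedFacts.

Section Completion.
Variable R : realType.
Variable N : c00 R -> R.
Hypothesis normN : is_norm N.
Hypothesis eqnN : schlumprecht_equation N.
Variable S : completeNormedModType R.
Variable iota : {linear c00 R -> S}.
Hypothesis isoN : forall x, `|iota x| = N x.
Hypothesis dense_iota : dense (range iota).

Lemma near_iota (y : S) e : 0 < e -> exists x, `|y - iota x| < e.
Proof.
move=> e0.
have [z [bz [x _ xz]]] := dense_iota (ex_intro _ y (ballxx y e0)) (@ball_open R S y e).
have bz' : ball (y : S) e z := bz.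
by exists x; rewrite xz; move: bz'; rewrite -(@ball_normE R S).
Qed.

(** The value at [y] is characterised by [rel], simultaneous approximation of [y] by [iota x] and of
    the value by [g x]. Completeness of [W] gives existence, and uniqueness turns approximations
    into linearity. *)
Lemma extend (W : completeNormedModType R) (g : c00 R -> W) (B : R) : 0 <= B ->
  (forall a x y, g (a *: x + y) = a *: g x + g y) ->
  (forall x, `|g x| <= B * N x) ->
  exists G : {linear S -> W}, (forall x, G (iota x) = g x) /\
    (forall y, `|G y| <= B * `|y|).
Proof.
move=> B0 glin gB.
have gsub x y : g (x - y) = g x - g y.
  by rewrite addrC -scaleN1r glin scaleN1r addrC.
have gdist x x' y e : `|y - iota x| < e -> `|y - iota x'| < e ->
    `|g x - g x'| <= B * (2 * e).
  move=> h h'; rewrite -gsub; apply: le_trans (gB _) _; rewrite ler_wpM2l // -isoN linearB.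
  have -> : iota x - iota x' = (y - iota x') - (y - iota x) by rewrite opprB [RHS]addrC addrA subrK.
  apply: le_trans (ler_normB _ _) _; lra.
pose rel y w := forall e, 0 < e -> exists x, `|y - iota x| < e /\ `|w - g x| < e.
have uniq y w w' : rel y w -> rel y w' -> w = w'.
  move=> h h'; apply/eqP; rewrite -subr_eq0 -normr_le0; apply/ler_addgt0Pr => e e0.
  pose e' := e / (2 + 2 * B).
  have d0 : 0 < 2 + 2 * B by lra.
  have e'0 : 0 < e' by rewrite divr_gt0.
  have [x [h1 h2]] := h _ e'0; have [x' [h1' h2']] := h' _ e'0.
  have h3 := gdist _ _ _ _ h1 h1'.
  have -> : w - w' = (w - g x) + (g x - g x') - (w' - g x').
    by rewrite addrA subrK opprB addrA subrK.
  have h4 := ler_normB ((w - g x) + (g x - g x')) (w' - g x').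
  have h5 := ler_normD (w - g x) (g x - g x').
  have : e = e' * (2 + 2 * B) by rewrite /e' divfK // gt_eqF.
  lra.
have ex y : exists w, rel y w.
  have e0 (k : nat) : 0 < k.+1%:R^-1 :> R by rewrite invr_gt0 ltr0n.
  have [s hs] := choice (fun k => near_iota y (e0 k)).
  have small e : 0 < e -> \forall k \near \oo, k.+1%:R^-1 < e :> R.
    move=> e0'; near=> k; rewrite -[e]invrK ltf_pV2 ?posrE ?invr_gt0 ?ltr0n //.
    apply: lt_le_trans (truncnS_gt _) _; rewrite ler_nat ltnS.
    near: k; exact: nbhs_infty_ge.
  have : cvg ((g \o s) @ \oo).
    apply/cauchy_cvgP/cauchy_exP => e e0'.
    have d0 : 0 < 2 * B + 1 by lra.
    have e'0 : 0 < e / (2 * B + 1) by rewrite divr_gt0.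
    have [K _ hK] := small _ e'0.
    exists (g (s K)); exists K => // k /= Kk; rewrite -ball_normE /=.
    have hk := hK k Kk; have hKK := hK K (leqnn K).
    apply: le_lt_trans (gdist _ _ y (e / (2 * B + 1)) _ _) _.
    - exact: lt_trans (hs K) hKK.
    - exact: lt_trans (hs k) hk.
    - have : e = e / (2 * B + 1) * (2 * B + 1) by rewrite divfK // gt_eqF.
      lra.
  move=> /cvg_ex[w hw]; exists w => e e0'.
  have [K1 _ h1] := small _ e0'.
  have /cvgrPdist_lt/(_ e e0')[K2 _ h2] := hw.
  exists (s (maxn K1 K2)); split.
    by apply: lt_trans (hs _) (h1 _ _) => /=; exact: leq_maxl.
  by apply: (h2 (maxn K1 K2)) => /=; exact: leq_maxr.
have [G hG] := choice ex.
have Glin : linear G.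
  move=> a u v; apply: (uniq (a *: u + v)) => // e e0.
  have d0 : 0 < `|a| + 1 by apply: ltr_wpDl.
  have e'0 : 0 < e / (`|a| + 1) by rewrite divr_gt0.
  have [x [x1 x2]] := hG u _ e'0; have [x' [x1' x2']] := hG v _ e'0.
  have ee : e = e / (`|a| + 1) * (`|a| + 1) by rewrite divfK // gt_eqF.
  have aux (Z : normedModType R) (p q p' q' : Z) : `|p - p'| < e / (`|a| + 1) ->
      `|q - q'| < e / (`|a| + 1) -> `|(a *: p + q) - (a *: p' + q')| < e.
    move=> h h'; have -> : (a *: p + q) - (a *: p' + q') = a *: (p - p') + (q - q').
      by rewrite scalerBr addrACA -opprD.
    apply: le_lt_trans (ler_normD _ _) _; rewrite normrZ.
    have : `|a| * `|p - p'| <= `|a| * (e / (`|a| + 1)) by rewrite ler_wpM2l // ltW.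
    lra.
  by exists (a *: x + x'); rewrite linearP glin; split; exact: aux.
pose Gl : {linear S -> W} := HB.pack G (GRing.isLinear.Build R S W *:%R G Glin).
exists Gl; split=> [x|y] /=.
  by apply: (uniq (iota x)) => // e e0; exists x; rewrite !subrr !normr0.
apply/ler_addgt0Pr => e e0.
have d0 : 0 < 1 + B by lra.
have e'0 : 0 < e / (1 + B) by rewrite divr_gt0.
have [x [x1 x2]] := hG y _ e'0.
have h1 : `|G y| <= `|G y - g x| + `|g x| by rewrite -{1}[G y](subrK (g x)) ler_normD.
have h2 : `|iota x| <= `|y| + `|y - iota x|.
  rewrite -{1}[iota x](subKr y); exact: ler_normB.
have h3 := gB x; rewrite -isoN in h3.
have h4 : B * `|iota x| <= B * (`|y| + `|y - iota x|) by rewrite ler_wpM2l.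
have h5 : B * `|y - iota x| <= B * (e / (1 + B)) by rewrite ler_wpM2l // ltW.
have : e = e / (1 + B) * (1 + B) by rewrite divfK // gt_eqF.
lra.
Unshelve. all: by end_near. Qed.

(** The rough bound [B] gives continuity, which carries the constant [c] over from the dense range
    of [iota]. *)
Lemma dense_bound (W : normedModType R) (D : {linear S -> W}) (B c : R) :
  0 <= B -> 0 <= c -> (forall x, `|D x| <= B * `|x|) ->
  (forall a, `|D (iota a)| <= c * N a) -> forall x, `|D x| <= c * `|x|.
Proof.
move=> B0 c0 DB Dc x; apply/ler_addgt0Pr => e e0.
have d0 : 0 < B + c + 1 by lra.
have e'0 : 0 < e / (B + c + 1) by rewrite divr_gt0.
have [a ha] := near_iota x e'0.
have h1 : `|D x| <= `|D (x - iota a)| + `|D (iota a)|.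
  have -> : D x = D (x - iota a) + D (iota a) by rewrite -linearD subrK.
  exact: ler_normD.
have h2 : `|iota a| <= `|x| + `|x - iota a|.
  rewrite -{1}[iota a](subKr x); exact: ler_normB.
have h3 := Dc a; rewrite -isoN in h3.
have h4 := DB (x - iota a).
have h5 : c * `|iota a| <= c * (`|x| + `|x - iota a|) by rewrite ler_wpM2l.
have h6 : (B + c) * `|x - iota a| <= (B + c) * (e / (B + c + 1)).
  by apply: ler_wpM2l; [lra | exact: ltW].
have : e = e / (B + c + 1) * (B + c + 1) by rewrite divfK // gt_eqF.
lra.
Qed.

End Completion.

Section Combinations.
Variable R : realType.
Implicit Types a : c00 R.

Lemma sum_c00_widen (V : lmodType R) (F : nat -> V) a I J :
  (forall i, (I <= i)%N -> a i = 0) -> (I <= J)%N ->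
  \sum_(i < J) a i *: F i = \sum_(i < I) a i *: F i.
Proof.
move=> aI IJ; rewrite [RHS](big_ord_widen J (fun i => a i *: F i) IJ).
rewrite [RHS]big_mkcond; apply: eq_bigr => i _; case: ltnP => // /aI ->.
by rewrite scale0r.
Qed.

Lemma combination_map (V : lmodType R) (F : nat -> V) :
  exists T : c00 R -> V,
    (forall b a a', T (b *: a + a') = b *: T a + T a') /\
    (forall a I, (forall i, (I <= i)%N -> a i = 0) -> T a = \sum_(i < I) a i *: F i).
Proof.
have [bd hbd] := choice (@c00_bound R).
pose T a := \sum_(i < bd a) a i *: F i.
have TE a I : (forall i, (I <= i)%N -> a i = 0) -> T a = \sum_(i < I) a i *: F i.
  move=> aI; rewrite -(sum_c00_widen F aI (leq_maxl I (bd a))).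
  by rewrite (sum_c00_widen F (hbd a) (leq_maxr _ _)).
exists T; split=> // b a a'.
pose J := maxn (bd a) (bd a').
have aJ i : (J <= i)%N -> a i = 0 by rewrite geq_max => /andP[/hbd].
have a'J i : (J <= i)%N -> a' i = 0 by rewrite geq_max => /andP[_ /hbd].
rewrite (TE _ J) => [|i iJ]; last by rewrite c00_addE c00_scaleE aJ // a'J // mulr0 addr0.
rewrite (TE a J) // (TE a' J) // scaler_sumr -big_split; apply: eq_bigr => i _.
by rewrite c00_addE c00_scaleE scalerDl scalerA.
Qed.

(** Coordinates are bounded by the norm, and the numbers [2 ^- (i + 6)] sum to at most [1 / 32]. *)
Lemma small_combination (N : c00 R -> R) (V : normedModType R) (G : nat -> V) (c : R) a I :
  schlumprecht_equation N -> 0 <= c ->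
  (forall i, `|G i| <= c * 2 ^- (i + 6)) ->
  `|\sum_(i < I) a i *: G i| <= c / 32 * N a.
Proof.
move=> eqnN c0 hG; apply: le_trans (ler_norm_sum _ _ _) _.
have Na0 : 0 <= N a by apply: le_trans (N_coord eqnN a 0); exact: normr_ge0.
apply: (@le_trans _ _ (\sum_(i < I) N a * (c * 2 ^- (i + 6)))).
  apply: ler_sum => i _; rewrite normrZ; apply: ler_pM => //; exact: N_coord.
rewrite -mulr_sumr -mulr_sumr.
have e : \sum_(i < I) 2 ^- (i + 6) = 1 / 32 - 1 / 32 * 2 ^- I :> R.
  elim: (I) => [|J IH]; first by rewrite big_ord0 expr0 invr1; ring.
  rewrite big_ord_recr /= IH exprD [2 ^+ J.+1]exprS; field; rewrite expf_eq0 /=; lra.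
rewrite mulrC ler_wpM2r // ler_wpM2l // e.
have : 0 < 2 ^- I :> R by rewrite invr_gt0 exprn_gt0.
lra.
Qed.

End Combinations.

(** * Blocks close to an infinite-dimensional subspace *)

Section Blocks.
Variable R : realType.
Variable N : c00 R -> R.
Hypothesis normN : is_norm N.
Hypothesis eqnN : schlumprecht_equation N.
Variable S : completeNormedModType R.
Variable iota : {linear c00 R -> S}.
Hypothesis isoN : forall x, `|iota x| = N x.
Hypothesis dense_iota : dense (range iota).
Variable Y : set S.
Hypothesis Y0 : Y 0.
Hypothesis Ylin : forall a u v, Y u -> Y v -> Y (a *: u + v).
Hypothesis Y_infinite : ~ finite_dimensional Y.

Definition near_subspace (d : R) (v : c00 R) : Prop :=
  exists2 z, Y z & `|z - iota v| <= d.

Lemma near_subspace_add d e u v : near_subspace d u -> near_subspace e v ->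
  near_subspace (d + e) (u + v).
Proof.
move=> [z Yz hz] [z' Yz' hz']; exists (z + z').
  by rewrite -[z]scale1r; exact: Ylin.
rewrite linearD opprD addrACA; apply: le_trans (ler_normD _ _) _; exact: lerD.
Qed.

Lemma near_subspace_scale d (a : R) u : 0 <= a -> near_subspace d u ->
  near_subspace (a * d) (a *: u).
Proof.
move=> a0 [z Yz hz]; exists (a *: z).
  by rewrite -[_ *: _]addr0; exact: Ylin.
by rewrite linearZ -scalerBr normrZ ger0_norm // ler_wpM2l.
Qed.

Lemma near_subspace_le d e u : d <= e -> near_subspace d u -> near_subspace e u.
Proof. by move=> de [z Yz hz]; exists z => //; exact: le_trans hz de. Qed.

Lemma near_subspace0 : near_subspace 0 0.
Proof. by exists 0 => //; rewrite linear0 subrr normr0. Qed.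

Lemma N_head lo (x : c00 R) (e : R) : 0 <= e -> (forall m, (m < lo)%N -> `|x m| <= e) ->
  N (restr [set m | (m < lo)%N] x) <= lo%:R * e.
Proof.
move=> e0 h; apply: N_le_trees => // t pt st.
set y := restr _ x.
have ym m : `|y m| = if (m < lo)%N then `|x m| else 0.
  rewrite /y /= /restr_fun; have [ml|lm] := ltnP m lo; first by rewrite mem_set.
  by rewrite memNset ?normr0 //= => /= ; rewrite ltnNge lm.
apply: le_trans (eval_le_leaves t (absf_ge0 y)) _.
apply: (@le_trans _ _ (\sum_(m <- leaves t) (m < lo)%N%:R * e)).
  apply: ler_sum => m _; rewrite /absf ym.
  by case: ifPn => [/h|_]; rewrite ?mul1r ?mul0r.
rewrite -mulr_suml ler_wpM2r //.
by apply: sum_indicator_le; exact: (sorted_uniq ltn_trans ltnn).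
Qed.

(** The first [lo] coordinate functionals extend to [S], and their common kernel in [Y] is still
    infinite-dimensional. A finitely supported approximation of a vector there has small first
    coordinates, which can be cut off. *)
Lemma tail_blocks lo (d : R) : 0 < d -> exists hi w,
  [/\ supp_in lo hi w, N w <= 1, 3 / 4 <= N w & near_subspace d w].
Proof.
move=> d0.
have coord m : exists phi : {linear S -> R^o}, (forall x, phi (iota x) = x m) /\
    (forall y, `|phi y| <= 1 * `|y|).
  have lin a (u v : c00 R) : ((a *: u + v) m : R^o) = a *: (u m : R^o) + v m by [].
  have bd (x : c00 R) : `|x m : R^o| <= 1 * N x by rewrite mul1r; exact: N_coord.
  exact: (extend isoN dense_iota ler01 lin bd).
have [phi hphi] := choice coord.
pose Yn n := [set y | Y y /\ forall m, (m < n)%N -> phi m y = 0].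
have Yn_inf n : ~ finite_dimensional (Yn n).
  elim: n => [|n IH].
    suff -> : Yn 0%N = Y by [].
    by apply/seteqP; split=> y /=; [case|move=> Yy; split].
  have -> : Yn n.+1 = Yn n `&` [set y | phi n y = 0].
    apply/seteqP; split=> y /=.
      by move=> [Yy h]; split; [split=> // m mn; apply: h; rewrite ltnS ltnW|exact: h].
    move=> [[Yy h] hn]; split=> // m; rewrite ltnS leq_eqVlt => /predU1P[->//|]; exact: h.
  apply: not_finite_dim_kernel => //.
    move=> a u v [Yu hu] [Yv hv]; split; first exact: Ylin.
    by move=> m mn; rewrite linearP hu // hv // scaler0 addr0.
  by move=> a u v; rewrite linearP.
have [y [[Yy hy] y0]] : exists y, Yn lo y /\ y != 0.
  apply: contrapT => hn; apply: (Yn_inf lo); exists 0%N, (fun=> 0) => y Yy.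
  exists (fun=> 0); rewrite big_ord0; apply: contrapT => /eqP y0.
  by apply: hn; exists y.
(* With norm [7 / 8], an error of at most [1 / 8] keeps [N w] between [3 / 4] and 1. *)
pose z := (7 / 8 / `|y|) *: y.
have ny0 : 0 < `|y| by rewrite normr_gt0.
have nz : `|z| = 7 / 8.
  by rewrite normrZ ger0_norm ?divfK ?gt_eqF // divr_ge0 // ltW.
have Yz : Y z by rewrite -[z]addr0; exact: Ylin.
have hz m : (m < lo)%N -> phi m z = 0 by move=> ml; rewrite linearZ /= hy // scaler0.
(* The total error is [e] for the approximation plus at most [lo * e] for the removed head. *)
pose e := Num.min (1 / 8) d / (1 + lo%:R).
have lo0 : 0 < 1 + lo%:R :> R by apply: ltr_wpDr.
have mn0 : 0 < Num.min (1 / 8) d by rewrite lt_min d0 andbT; lra.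
have e0 : 0 < e by rewrite divr_gt0.
have eE : (1 + lo%:R) * e = Num.min (1 / 8) d by rewrite /e mulrC divfK // gt_eqF.
have [x hx] := near_iota dense_iota z e0.
pose w := restr [set m | (lo <= m)%N] x.
pose h := restr [set m | (m < lo)%N] x.
have xwh : x = w + h.
  apply: c00_ext => m; rewrite c00_addE /= /restr_fun.
  have [lm|ml] := leqP lo m.
    by rewrite mem_set // memNset ?addr0 //= ltnNge lm.
  by rewrite memNset ?mem_set ?add0r //= leqNgt ml.
have hN : N h <= lo%:R * e.
  apply: N_head (ltW e0) _ => m ml; have [p1 p2] := hphi m.
  rewrite -p1 -[phi m (iota x)]subr0 -(hz m ml) -linearB -normrN -linearN opprB.
  by apply: le_trans (p2 _) _; rewrite mul1r ltW.
have zw : `|z - iota w| <= Num.min (1 / 8) d.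
  have -> : z - iota w = (z - iota x) + iota h.
    by rewrite xwh linearD opprD addrA subrK.
  apply: le_trans (ler_normD _ _) _; rewrite isoN -eE mulrDl mul1r.
  by apply: lerD => //; exact: ltW.
have zw1 : `|z - iota w| <= 1 / 8 by apply: le_trans zw _; rewrite ge_min lexx.
have zw2 : `|z - iota w| <= d by apply: le_trans zw _; rewrite ge_min lexx orbT.
have [hi hhi] := c00_bound w.
exists hi, w; split.
- move=> m wm; apply/andP; split.
    rewrite leqNgt; apply/negP => ml; move/eqP: wm; apply.
    by rewrite /w /= /restr_fun memNset //= leqNgt ml.
  by rewrite ltnNge; apply/negP => hm; move/eqP: wm; apply; exact: hhi.
- rewrite -isoN; have : `|iota w| <= `|z| + `|z - iota w|.
    rewrite -{1}[iota w](subKr z); exact: ler_normB.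
  by rewrite nz; lra.
- rewrite -isoN; have : `|z| <= `|z - iota w| + `|iota w|.
    rewrite -{1}[z](subrK (iota w)); exact: ler_normD.
  by rewrite nz; lra.
- by exists z.
Qed.

End Blocks.

(** * Construction of the copy of [S] and of the projection *)

Theorem theorem2p1 (R : realType) (S : completeNormedModType R)
    (hS : is_schlumprecht_space S) :
  complementably_minimal S.
Proof.
have [N [iota [normN eqnN [isoN dense_iota]]]] := hS.
move=> Y [[Y0' Ylin'] Yclosed] Yinf.
have Y0 : Y 0 by move: Y0'; rewrite inE.
have Ylin a u v : Y u -> Y v -> Y (a *: u + v).
  by move=> Yu Yv; have := Ylin' a u v (mem_set Yu) (mem_set Yv); rewrite inE.
have averages n lo d : (0 < n)%N -> 0 < d ->
    exists hi us, l1_average N (near_subspace iota Y) n lo hi d us.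
  apply: james => //.
  - exact: near_subspace0.
  - exact: near_subspace_add.
  - exact: near_subspace_scale.
  - exact: near_subspace_le.
  - exact: (tail_blocks normN eqnN isoN dense_iota Y0 Ylin Yinf).
have [L [K [M [U bs]]]] := selection normN averages.
pose y i := average (U i).
have [z hz] : exists z : nat -> S, forall i, Y (z i) /\ `|z i - iota (y i)| <= 2 ^- (i + 6).
  have h i : exists z, Y z /\ `|z - iota (y i)| <= 2 ^- (i + 6).
    by have [z Yz zy] := bs_approx bs i; exists z.
  by have [z hz] := choice h; exists z.
have Mmono i j : (i <= j)%N -> (M i <= M j)%N := @M_mono M (bs_M bs) i j.
have ysupp i : supp_in (M i) (M i.+1) (y i).
  by apply: average_supp => u; exact: (bs_supp bs).
have [Q [Qlin Qle Qy]] := coefficient_map normN eqnN (bs_M bs) ysupp (bs_ge bs).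
have [T [Tlin TE]] := combination_map z.
(* The averages contribute 8 and the passage from [y i] to [z i] at most [1 / 32]. *)
have Tle a : `|T a| <= 9 * N a.
  have [I aI] := c00_bound a; rewrite (TE a I aI).
  have -> : \sum_(i < I) a i *: z i =
      iota (\sum_(i < I) a i *: y i) + \sum_(i < I) a i *: (z i - iota (y i)).
    rewrite linear_sum -big_split; apply: eq_bigr => i _ /=.
    by rewrite linearZ /= -scalerDr addrC subrK.
  apply: le_trans (ler_normD _ _) _; rewrite isoN.
  have h1 : N (\sum_(i < I) a i *: y i) <= 8 * N a.
    apply: (@upper_estimate R N normN eqnN L K M U) => //.
    - exact: bs_L0 bs.
    - exact: bs_Lmono bs.
    - exact: bs_growth bs.
    - exact: bs_tiny bs.
    - exact: bs_U0 bs.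
    - exact: bs_supp bs.
    - exact: bs_sep bs.
    - exact: bs_le1 bs.
    - exact: bs_split bs.
  have h2 := @small_combination R N S (fun i => z i - iota (y i)) 1 a I eqnN ler01
    (fun i => eq_ind_r (fun t => _ <= t) (hz i).2 (mul1r _)).
  have := N_ge0 normN a; lra.
have [Th [ThE ThB]] := extend isoN dense_iota (ler0n R 9) Tlin Tle.
have Qlin' a u v : iota (Q (a *: u + v)) = a *: iota (Q u) + iota (Q v).
  by rewrite Qlin linearP.
have Qle' x : `|iota (Q x)| <= 4 * N x by rewrite isoN.
have [Qh [QhE QhB]] := extend isoN dense_iota (ler0n R 4) Qlin' Qle'.
pose V : {linear S -> S} := Qh \o Th.
pose D : {linear S -> S} := V \- idfun.
have VD x : `|V x - x| <= 1 / 2 * `|x|.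
  have h : `|D x| <= 1 / 8 * `|x|.
    (* The rough bound is 37 = 4 * 9 + 1. On finitely supported vectors [Q (y i)] is the basis
       vector [i], so only the images of [z i - iota (y i)] remain, with total factor [4 / 32]. *)
    apply: (dense_bound isoN dense_iota (B := 37)) => //.
    - move=> u; apply: le_trans (ler_normB _ _) _ => /=.
      have h1 := QhB (Th u); have h2 := ThB u; lra.
    - move=> a /=; rewrite ThE.
      have [I aI] := c00_bound a; rewrite (TE a I aI).
      have -> : Qh (\sum_(i < I) a i *: z i) - iota a =
          \sum_(i < I) a i *: (Qh (z i - iota (y i))).
        have aE : a = \sum_(i < I) a i *: Q (y i).
          apply: c00_ext => k; rewrite c00_sumE.
          rewrite (eq_bigr (fun i : 'I_I => if (i : nat) == k then a k else 0)); last first.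
            move=> i _; rewrite c00_scaleE Qy eq_sym; case: eqP => [->|_]; rewrite ?mulr1 ?mulr0 //.
          have [kI|Ik] := ltnP k I.
            rewrite (bigD1 (Ordinal kI)) //= eqxx big1 ?addr0 // => i.
            by rewrite -val_eqE /= => /negbTE ->.
          by rewrite aI // big1 // => i _; rewrite if_same.
        have -> : iota a = \sum_(i < I) a i *: iota (Q (y i)).
          by rewrite {1}aE linear_sum; apply: eq_bigr => i _; rewrite linearZ.
        rewrite linear_sum -sumrB; apply: eq_bigr => i _.
        by rewrite linearZ /= -scalerBr -QhE -linearB.
      have := @small_combination R N S (fun i => Qh (z i - iota (y i))) 4 a I eqnN (ler0n R 4) => h.
      apply: le_trans (h _) _.
        move=> i; apply: le_trans (QhB _) _; rewrite ler_wpM2l //; exact: (hz i).2.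
      have := N_ge0 normN a; lra.
  have -> : V x - x = D x by [].
  have := normr_ge0 x; lra.
have [W [VW WV WB]] := perturbation_inverse VD.
pose P : {linear S -> S} := Th \o (W \o Qh).
have PT x : P (Th x) = Th x.
  by rewrite /= (_ : Qh (Th x) = V x) // WV.
have Pcont : continuous P.
  apply: (bounded_continuous (B := 72)) => x /=.
  have h1 := ThB (W (Qh x)); have h2 := WB (Qh x); have h3 := QhB x; lra.
have Tcont : continuous Th := bounded_continuous ThB.
have ZY : range Th `<=` Y.
  (* On finitely supported vectors the values are finite combinations of the [z i], hence in [Y];
     density and closedness of [Y] give the rest. *)
  move=> _ [x _ <-]; apply: Yclosed; apply/closure_near => e e0.
  have e'0 : 0 < e / 9 by rewrite divr_gt0.
  have [a ha] := near_iota dense_iota x e'0.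
  exists (T a).
    have [I aI] := c00_bound a; rewrite (TE a I aI).
    elim/big_ind: _ => // [u v Yu Yv|i _]; first by rewrite -[u]scale1r; exact: Ylin.
    by rewrite -[_ *: _]addr0; apply: Ylin => //; exact: (hz i).1.
  rewrite -ThE -linearB; apply: le_lt_trans (ThB _) _; lra.
exists (range Th); split => //.
- split.
    split; first by rewrite inE; exists 0 => //; rewrite linear0.
    move=> a u v; rewrite !inE => -[x _ <-] [x' _ <-]; exists (a *: x + x') => //.
    by rewrite linearP.
  move=> p /closure_near cl.
  (* The range is closed because [P] fixes it and is continuous; its norm is at most 72 = 9 * 2 * 4,
     which explains [e / 73]. *)
  have -> : p = P p; last by exists (W (Qh p)).
  apply/eqP; rewrite -subr_eq0 -normr_le0; apply/ler_addgt0Pr => e e0.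
  have e'0 : 0 < e / 73 by rewrite divr_gt0.
  have [q [x _ <-] pq] := cl _ e'0.
  have -> : p - P p = (p - Th x) - P (p - Th x).
    by rewrite linearB PT opprB addrA subrK.
  apply: le_trans (ler_normB _ _) _.
  have h1 := ThB (W (Qh (p - Th x))); have h2 := WB (Qh (p - Th x)).
  have h3 := QhB (p - Th x).
  rewrite [P _]/=; lra.
- exists Th, (W \o Qh); split.
  + by [].
  + exact: WV.
  + exact: Tcont.
  apply: continuous_subspaceT.
  apply: (bounded_continuous (G := W \o Qh) (B := 8)) => x /=.
  have h2 := WB (Qh x); have h3 := QhB x; lra.
- exists P; split=> //.
    by move=> x; rewrite [P x in LHS]/= PT.
  apply/seteqP; split=> [_ [x _ <-]|_ [x _ <-]]; first by exists (W (Qh x)).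
  by exists (Th x) => //; exact: PT.
Qed.
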